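(* Let $u\in L^\infty([0,1]\times\mathbb T^2)$ be a vector field with $\nabla\cdot u=0$ and let $\theta_0\in L^2(\mathbb T^2)$. For all $\kappa>0$, let $\theta^\kappa$ solve $$\partial_t\theta^\kappa-\kappa\Delta\theta^\kappa+u\cdot\nabla\theta^\kappa=0\ \text{ in }(0,1)\times\mathbb T^2,\qquad\theta^\kappa(0,\cdot)=\theta_0.$$ Suppose that for some $\theta\in L^\infty([0,1],L^2(\mathbb T^2))$ and some sequence of positive numbers $\kappa_j\to0$, $\theta^{\kappa_j}\rightharpoonup\theta$ weakly-$*$ in $L^\infty([0,1],L^2(\mathbb T^2))$. Suppose also that $E(t):=\|\theta(t,\cdot)\|_{L^2(\mathbb T^2)}^2$ is not continuous (i.e. does not coincide for a.e. $t\in[0,1]$ with a continuous function). Then, for any $s>0$, $$\lim_{j\to\infty}\|\theta^{\kappa_j}\|_{L^\infty([0,1],H^s(\mathbb T^2))}=\infty.$$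
   Context: $\mathbb T^2$ is $[0,\sqrt2]\times[0,1]$ with periodic boundary. $\|f\|_{H^s(\mathbb T^2)}:=\|(-\Delta)^{s/2}f\|_{L^2(\mathbb T^2)}$, with $(-\Delta)^{s/2}$ defined via Fourier series (it annihilates constants; value $+\infty$ if not in $L^2$). *)

(* Defs.v *)
From HB Require Import structures.
From mathcomp Require Import all_boot all_order all_algebra.
From mathcomp Require Import all_classical all_reals all_analysis.
From mathcomp Require Import ess_sup_inf complex.

Set Implicit Arguments.
Unset Strict Implicit.
Unset Printing Implicit Defensive.

Import Order.TTheory GRing.Theory Num.Theory.
Import numFieldNormedType.Exports.

Local Open Scope classical_set_scope.
Local Open Scope ring_scope.

(* A function on the torus T^2 is represented by a function on R * R of which
   only the values on the fundamental domain [0, sqrt 2] x [0, 1] matter; a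
   function on [0, 1] x T^2 is represented likewise by a function on
   R * (R * R), with time as first coordinate. *)

Section Torus.
Context {R : realType}.

Definition torus : set (measurableTypeR R * measurableTypeR R) :=
  `[0, Num.sqrt 2] `*` `[0, 1].

Definition spacetime :
    set (measurableTypeR R * (measurableTypeR R * measurableTypeR R)) :=
  `[0, 1] `*` torus.

Definition leb1 : {sigma_finite_measure set (measurableTypeR R) -> \bar R} :=
  @lebesgue_measure R.

Definition leb2 := (leb1 \x leb1)%E.

HB.instance Definition _ := Measure.on leb2.

(* The library registers no such instance for products of sigma-finite
   measures; it is needed for leb3. *)
Lemma leb2_sigma_finite : sigma_finite setT leb2.
Proof.
have /sigma_finiteP[F [TF ndF Foo]] := sigma_finiteT leb1.
exists (fun n => F n `*` F n).
  rewrite -setXTT TF predeqE => -[x y]; split.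
    move=> [/= [n _ Fnx] [k _ Fky]]; exists (maxn n k) => //; split.
      by move: x Fnx; exact/subsetPset/ndF/leq_maxl.
    by move: y Fky; exact/subsetPset/ndF/leq_maxr.
  by move=> [n _ []/= ? ?]; split; exists n.
move=> k; have [mFk Fkoo] := Foo k; split; first exact: measurableX.
by rewrite /leb2 product_measure1E// lte_mul_pinfty// ge0_fin_numE.
Qed.

HB.instance Definition _ :=
  Measure_isSigmaFinite.Build _ _ _ leb2 leb2_sigma_finite.

Definition leb3 := (leb1 \x leb2)%E.

HB.instance Definition _ := Measure.on leb3.

Definition torus_int (f : R * R -> R) : R := \int[leb2]_(x in torus) f x.

Definition spacetime_int (f : R * (R * R) -> R) : R :=
  \int[leb3]_(z in spacetime) f z.

Definition slice (f : R * (R * R) -> R) (t : R) : R * R -> R :=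
  fun x => f (t, x).

Definition L2norm (f : R * R -> R) : \bar R :=
  'N[leb2]_2%:E[EFin \o (f \_ torus)].

Definition in_L2 (f : R * R -> R) : Prop :=
  measurable_fun torus f /\ (L2norm f < +oo)%E.

(* k-th frequency of the torus: 2 pi (k.1 / sqrt 2, k.2 / 1). *)
Definition freq (k : int * int) : R * R :=
  (2 * pi * k.1%:~R / Num.sqrt 2, 2 * pi * k.2%:~R).

Definition freq_norm (k : int * int) : R :=
  Num.sqrt ((freq k).1 ^+ 2 + (freq k).2 ^+ 2).

Definition phase (k : int * int) (x : R * R) : R :=
  (freq k).1 * x.1 + (freq k).2 * x.2.

(* |T^2|^-1 \int_(T^2) f(x) e^(- i freq_k . x) dx, with |T^2| = sqrt 2. *)
Definition fourier_coef (f : R * R -> R) (k : int * int) : R[i] :=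
  ((Num.sqrt 2)^-1 * torus_int (fun x => f x * cos (phase k x)) +i*
   - ((Num.sqrt 2)^-1 * torus_int (fun x => f x * sin (phase k x))))%C.

(* g = (-Delta)^(s/2) f in L^2; for s > 0 the multiplier is 0 at k = 0. *)
Definition is_frac_laplacian (s : R) (f g : R * R -> R) : Prop :=
  in_L2 g /\
  forall k, fourier_coef g k = (freq_norm k `^ s)%:C%C * fourier_coef f k.

(* The function g is determined almost everywhere by f, so that the infimum
   ranges over at most one value; it is +oo when (-Delta)^(s/2) f is not in
   L^2. *)
Definition Hsnorm (s : R) (f : R * R -> R) : \bar R :=
  ereal_inf [set L2norm g | g in [set g | is_frac_laplacian s f g]].

(* Essential supremum over [0, 1]; meant for F >= 0, as F is extended by 0. *)
Definition Linf_time (F : R -> \bar R) : \bar R :=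
  ess_sup leb1 (F \_ `[0, 1]).

Definition in_Linf_L2 (f : R * (R * R) -> R) : Prop :=
  measurable_fun spacetime f /\
  (Linf_time (fun t => L2norm (slice f t)) < +oo)%E.

Definition in_L1_L2 (f : R * (R * R) -> R) : Prop :=
  measurable_fun spacetime f /\
  (\int[leb1]_(t in `[0%R, 1%R]) L2norm (slice f t) < +oo)%E.

(* Finiteness of the L^2([0, 1], H^1) norm. *)
Definition finite_L2_H1 (f : R * (R * R) -> R) : Prop :=
  (\int[leb1]_(t in `[0%R, 1%R]) (Hsnorm 1%R (slice f t) ^+ 2) < +oo)%E.

(* Weak-* convergence in L^oo([0, 1], L^2), the dual of L^1([0, 1], L^2). *)
Definition weakstar_cvg (f : nat -> R * (R * R) -> R) (g : R * (R * R) -> R)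
    : Prop :=
  forall psi, in_L1_L2 psi ->
    spacetime_int (f j \* psi) @[j --> \oo] --> spacetime_int (g \* psi).

Definition in_Linf (u : R * (R * R) -> R * R) : Prop :=
  measurable_fun spacetime u /\
  (ess_sup leb3 ((fun z => `|u z|%:E) \_ spacetime) < +oo)%E.

(* All iterated directional derivatives exist and are continuous. *)
Definition smooth (phi : R * (R * R) -> R) : Prop :=
  forall vs : seq (R * (R * R)),
    let dphi := foldr (fun v (g : R * (R * R) -> R) => 'D_v g) phi vs in
    continuous dphi /\ forall z v, derivable dphi z v.

Definition torus_periodic (phi : R * (R * R) -> R) : Prop :=
  forall t x y, phi (t, (x + Num.sqrt 2, y)) = phi (t, (x, y)) /\
                phi (t, (x, y + 1)) = phi (t, (x, y)).

Definition dt (phi : R * (R * R) -> R) : R * (R * R) -> R :=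
  'D_((1, (0, 0)) : R * (R * R)) phi.
Definition dx (phi : R * (R * R) -> R) : R * (R * R) -> R :=
  'D_((0, (1, 0)) : R * (R * R)) phi.
Definition dy (phi : R * (R * R) -> R) : R * (R * R) -> R :=
  'D_((0, (0, 1)) : R * (R * R)) phi.

Definition laplacian (phi : R * (R * R) -> R) : R * (R * R) -> R :=
  dx (dx phi) \+ dy (dy phi).

Definition advect (u : R * (R * R) -> R * R) (phi : R * (R * R) -> R)
    : R * (R * R) -> R :=
  fun z => (u z).1 * dx phi z + (u z).2 * dy phi z.

(* div u = 0 in the sense of distributions on (0, 1) x T^2. *)
Definition div_free (u : R * (R * R) -> R * R) : Prop :=
  forall phi, smooth phi -> torus_periodic phi ->
    (exists a b, [/\ 0 < a, b < 1 &
       forall t x, ~~ (a <= t <= b) -> phi (t, x) = 0]) ->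
    spacetime_int (advect u phi) = 0.

(* Weak solution, in the energy class, of
     d_t theta - kappa Delta theta + u . grad theta = 0,  theta(0, .) = theta0,
   for div u = 0; the initial condition is the boundary term at t = 0 of the
   weak formulation. *)
Definition weak_solution (kappa : R) (u : R * (R * R) -> R * R)
    (theta0 : R * R -> R) (theta : R * (R * R) -> R) : Prop :=
  [/\ in_Linf_L2 theta, finite_L2_H1 theta &
    forall phi, smooth phi -> torus_periodic phi ->
      (forall x, phi (1, x) = 0) ->
      spacetime_int (fun z => theta z *
        (dt phi z + kappa * laplacian phi z + advect u phi z))
      + torus_int (fun x => theta0 x * phi (0, x)) = 0].

Definition energy (theta : R * (R * R) -> R) (t : R) : \bar R :=
  (L2norm (slice theta t) ^+ 2)%E.

Definition ae_eq_continuous (F : R -> \bar R) : Prop :=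
  exists2 c : R -> R, {within `[0, 1], continuous c} &
    {ae leb1, forall t, t \in `[0, 1] -> F t = (c t)%:E}.

End Torus.

(* Main.v *)
Require Import Defs.
From mathcomp Require Import all_boot all_order all_algebra.
From mathcomp Require Import all_classical all_reals all_analysis.
From mathcomp Require Import ess_sup_inf measurable_realfun complex.
From mathcomp Require Import ring lra zify.
Import Order.TTheory GRing.Theory Num.Theory.
Import numFieldNormedType.Exports.

Set Implicit Arguments.
Unset Strict Implicit.
Unset Printing Implicit Defensive.

Local Open Scope classical_set_scope.
Local Open Scope ring_scope.

(** Suppose that the norms do not tend to infinity: for some A there are
    arbitrarily large j for which the H^s norm of theta^(kappa_j)(t) is below A
    for almost every t.  Then the energy of theta coincides almost everywhere
    with a continuous function, because it is a uniform limit of such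
    functions, namely the energies of theta in finitely many Fourier modes.

    Each Fourier coefficient of theta is continuous in time, up to a null set
    of times.  Test the weak formulation against f(t,x) = b(t) cos(k.x + c),
    with b a trigonometric polynomial vanishing at t = 0 and t = 1: as kappa_j
    tends to 0 the diffusion term disappears, and theta itself solves the
    transport equation ([limit_equation]).  Hence the coefficient a(t) of theta(t) on cos(k.x + c)
    has a weak derivative, the integral over the torus of theta times
    u . grad cos(k.x + c), which is integrable in time.  A function with
    integrable weak derivative is a primitive of it up to a constant
    ([ae_continuous_of_weak_derivative]); in particular it
    coincides almost everywhere with a continuous function.

    The high frequencies of theta carry little energy, uniformly in time.  If
    the H^s norm of a function is below A then the Fourier modes of frequency
    at least N carry energy at most A^2 / N^(2s) ([sobolev_tail]).  Such a bound
    on finitely many modes, valid at almost every time along a subsequence,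
    survives in the weak-* limit ([weak_limit_energy_le]).  By Parseval's
    identity ([parseval]), at almost every time the energy of theta differs by
    at most A^2 / N^(2s) from its energy in the modes of the box of size N
    ([weak_limit_tail_le]), and this last quantity is continuous in time.

    Weak-* convergence passes to coefficients only after averaging in time.
    The bound is therefore transferred by a duality argument: the energy of the
    limit on the set of times where the bound would fail is tested against the
    approximating solutions, and Young's inequality concludes.

    Everything about Fourier series rests on the density in L^2 of
    trigonometric polynomials ([L2_dense]), which is needed on [0,1] and on the
    torus.  It is obtained without uniform approximation: for an algebra of
    bounded functions, f in [0,1] and n large, (1 - f^n)^(n 2^n) is close to 1
    where f < 1/2 and close to 0 where f > 1/2 ([cvg_kuhn]).  Bounded pointwise
    limits of trigonometric polynomials thus contain the indicators of
    rectangles, and Dynkin's theorem extends this to all measurable sets. *)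

(** * Integrals and almost everywhere statements *)

Lemma ae_imp d (T : measurableType d) (R : realType)
    (mu : {measure set T -> \bar R}) (P Q : T -> Prop) :
  (forall x, P x -> Q x) -> {ae mu, forall x, P x} -> {ae mu, forall x, Q x}.
Proof. by move=> PQ; apply: filterS. Qed.

Lemma ae_imp2 d (T : measurableType d) (R : realType)
    (mu : {measure set T -> \bar R}) (P Q S : T -> Prop) :
  (forall x, P x -> Q x -> S x) -> {ae mu, forall x, P x} ->
  {ae mu, forall x, Q x} -> {ae mu, forall x, S x}.
Proof. by move=> PQS; apply: filterS2. Qed.

Lemma ae_eq0_of_Rintegral_le0 d (T : measurableType d) (R : realType)
    (mu : {measure set T -> \bar R}) (D : set T) (h : T -> R) : measurable D ->
  mu.-integrable D (EFin \o h) -> (forall x, D x -> 0 <= h x) ->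
  \int[mu]_(x in D) h x <= 0 -> {ae mu, forall x, D x -> h x = 0}.
Proof.
move=> mD ih h0 ih0.
have ihE : (\int[mu]_(x in D) `|(EFin \o h) x|)%E = 0%E.
  transitivity (\int[mu]_(x in D) (h x)%:E)%E.
    by apply: eq_integral => x /set_mem Dx /=; rewrite ger0_norm// h0.
  apply/eqP; rewrite eq_le integral_ge0 ?andbT; last by move=> x Dx; rewrite lee_fin h0.
  by rewrite -[leLHS]fineK ?lee_fin//; exact: integrable_fin_num.
move/(ae_eq_integral_abs _ mD (measurable_int _ ih)) : ihE.
by apply: ae_imp => x /= hx /hx[].
Qed.

Lemma ae_le_Rintegral d (T : measurableType d) (R : realType)
    (mu : {measure set T -> \bar R}) (D : set T) (g h : T -> R) : measurable D ->
  mu.-integrable D (EFin \o g) -> mu.-integrable D (EFin \o h) ->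
  {ae mu, forall x, D x -> g x <= h x} ->
  \int[mu]_(x in D) g x <= \int[mu]_(x in D) h x.
Proof.
move=> mD ig ih gh; rewrite -subr_ge0 -RintegralB//.
have igh := integrableB mD ih ig.
have -> : \int[mu]_(x in D) (h x - g x) = \int[mu]_(x in D) `|h x - g x|.
  congr fine; apply: ae_eq_integral => //.
  - exact: measurable_int igh.
  - by apply: measurable_int; exact: (integrable_abse igh).
  - by apply: ae_imp gh => x gx /gx; rewrite -subr_ge0 => /ger0_norm ->.
exact: Rintegral_ge0.
Qed.

Lemma Rintegral_sum d (T : measurableType d) (R : realType)
    (mu : {measure set T -> \bar R})
    (D : set T) (I : Type) (s : seq I) (h : I -> T -> R) : measurable D ->
  (forall i, mu.-integrable D (EFin \o h i)) ->
  mu.-integrable D (fun x => (\sum_(i <- s) h i x)%:E) /\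
  \int[mu]_(x in D) (\sum_(i <- s) h i x) = \sum_(i <- s) \int[mu]_(x in D) h i x.
Proof.
move=> mD ih; elim: s => [|i s [IHi IHe]].
  rewrite big_nil; split.
    under eq_fun do rewrite big_nil; exact: integrable0.
  by under eq_Rintegral do rewrite big_nil; rewrite Rintegral_cst ?mul0r.
split.
  apply: eq_integrable (integrableD mD (ih i) IHi) => // x _.
  by rewrite big_cons EFinD.
under eq_Rintegral do rewrite big_cons.
by rewrite RintegralD// IHe big_cons.
Qed.

Lemma integrable_bmul d (T : measurableType d) (R : realType)
    (mu : {measure set T -> \bar R}) (D : set T) (f g : T -> R) (C : R) :
  measurable D -> mu.-integrable D (EFin \o f) -> measurable_fun D g ->
  (forall x, D x -> `|g x| <= C) -> mu.-integrable D (fun x => (g x * f x)%:E).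
Proof.
move=> mD intf mg gC; apply: (le_integrable mD _ _ (integrableZl mD C intf)).
  apply/measurable_EFinP/measurable_funM => //.
  by apply/measurable_EFinP; exact: measurable_int intf.
move=> x Dx /=; rewrite lee_fin !normrM ler_wpM2r//.
exact: le_trans (gC x Dx) (ler_norm C).
Qed.

(** * Square-integrable functions *)

Section SquareIntegrable.
Context d (T : measurableType d) (R : realType).
Variables (mu : {measure set T -> \bar R}) (D : set T).

Definition sqint (f : T -> R) : Prop :=
  measurable_fun D f /\ mu.-integrable D (fun x => (f x ^+ 2)%:E).

(** The integrand may fail to be integrable, in which case the value is meaningless;
    the algebraic rules below therefore ask for square-integrable arguments. *)
Definition ip (f g : T -> R) : R := \int[mu]_(x in D) (f x * g x).

Hypothesis mD : measurable D.

Lemma sqint_mul (f g : T -> R) : sqint f -> sqint g ->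
  mu.-integrable D (fun x => (f x * g x)%:E).
Proof.
move=> [mf intf] [mg intg].
apply: (le_integrable mD _ _ (integrableD mD intf intg)).
  by apply/measurable_EFinP; exact: measurable_funM.
move=> x _ /=; rewrite lee_fin normrM [leRHS]ger0_norm ?addr_ge0 ?sqr_ge0//.
rewrite -[f x ^+ 2]real_normK ?num_real// -[g x ^+ 2]real_normK ?num_real//.
have fg0 : 0 <= `|f x| * `|g x| by rewrite mulr_ge0.
by have := sqr_ge0 (`|f x| - `|g x|); nra.
Qed.

Lemma sqintD (f g : T -> R) : sqint f -> sqint g ->
  sqint (fun x => f x + g x).
Proof.
move=> Sf Sg; have Sfg := sqint_mul Sf Sg; case: Sf Sg => mf intf [mg intg].
split; first exact: measurable_funD.
have /(integrableD mD intf) := integrableD mD (integrableZl mD 2 Sfg) intg.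
apply: eq_integrable => // x _ /=.
by rewrite -EFinM -!EFinD; congr (_%:E); ring.
Qed.

Lemma sqintZ (a : R) (f : T -> R) : sqint f -> sqint (fun x => a * f x).
Proof.
move=> [mf intf]; split; first exact: measurable_funM.
apply: eq_integrable (integrableZl mD (a ^+ 2) intf) => // x _ /=.
by rewrite -EFinM exprMn.
Qed.

Lemma sqintB (f g : T -> R) : sqint f -> sqint g ->
  sqint (fun x => f x - g x).
Proof.
move=> Sf Sg; have := sqintD Sf (sqintZ (-1) Sg).
by under [in X in X -> _]eq_fun do rewrite mulN1r.
Qed.

Lemma sqint_bmul (f g : T -> R) (C : R) : sqint f -> measurable_fun D g ->
  (forall x, D x -> `|g x| <= C) -> sqint (fun x => f x * g x).
Proof.
move=> [mf intf] mg gC; split; first exact: measurable_funM.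
apply: (le_integrable mD _ _ (integrableZl mD (C ^+ 2) intf)).
  by apply/measurable_EFinP/measurable_funX; exact: measurable_funM.
move=> x Dx /=; rewrite lee_fin [leRHS]normrM mulrC exprMn normrM.
have C0 : 0 <= C by apply: le_trans (gC x Dx).
by rewrite ler_wpM2r// !normrX lerXn2r ?nnegrE// (ger0_norm C0) gC.
Qed.

Lemma sqint_cst (a : R) : (mu D < +oo)%E -> sqint (cst a).
Proof.
move=> muD; split; first exact: measurable_cst.
apply/integrableP; split; first by apply/measurable_EFinP; exact: (measurable_cst (a ^+ 2)).
rewrite (_ : (fun _ => _) = cst (`|a ^+ 2|%:E))// integral_cst//.
by rewrite lte_mul_pinfty// lee_fin.
Qed.

Lemma sqint_bounded (f : T -> R) (C : R) : (mu D < +oo)%E ->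
  measurable_fun D f -> (forall x, D x -> `|f x| <= C) -> sqint f.
Proof.
move=> muD mf fC; have := sqint_bmul (sqint_cst 1 muD) mf fC.
by under [in X in X -> _]eq_fun do rewrite mul1r.
Qed.

Lemma sqint_sum (I : Type) (s : seq I) (P : pred I) (F : I -> T -> R) :
  (mu D < +oo)%E ->
  (forall i, P i -> sqint (F i)) -> sqint (fun x => \sum_(i <- s | P i) F i x).
Proof.
move=> muD SF; elim: s => [|i s IHs].
  by under eq_fun do rewrite big_nil; exact: sqint_cst.
under eq_fun do rewrite big_cons.
by case Pi : (P i) => //; apply: sqintD => //; exact: SF.
Qed.

Lemma ipC (f g : T -> R) : ip f g = ip g f.
Proof. by apply: eq_Rintegral => x _; rewrite mulrC. Qed.

Lemma eq_ip (f f' g g' : T -> R) : {in D, f =1 f'} -> {in D, g =1 g'} ->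
  ip f g = ip f' g'.
Proof. by move=> ff' gg'; apply: eq_Rintegral => x xD; rewrite ff'// gg'. Qed.

Lemma ipDl (f g h : T -> R) : sqint f -> sqint g -> sqint h ->
  ip (fun x => f x + g x) h = ip f h + ip g h.
Proof.
move=> Sf Sg Sh; rewrite /ip; under eq_Rintegral do rewrite mulrDl.
by rewrite RintegralD//; exact: sqint_mul.
Qed.

Lemma ipZl (a : R) (f h : T -> R) : sqint f -> sqint h ->
  ip (fun x => a * f x) h = a * ip f h.
Proof.
move=> Sf Sh; rewrite /ip; under eq_Rintegral do rewrite -mulrA.
by rewrite RintegralZl//; exact: sqint_mul.
Qed.

Lemma ipBl (f g h : T -> R) : sqint f -> sqint g -> sqint h ->
  ip (fun x => f x - g x) h = ip f h - ip g h.
Proof.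
move=> Sf Sg Sh; rewrite /ip; under eq_Rintegral do rewrite mulrBl.
by rewrite RintegralB//; exact: sqint_mul.
Qed.

Lemma ipDr (f g h : T -> R) : sqint f -> sqint g -> sqint h ->
  ip h (fun x => f x + g x) = ip h f + ip h g.
Proof. by move=> *; rewrite ipC ipDl// ipC [ip g _]ipC. Qed.

Lemma ipZr (a : R) (f h : T -> R) : sqint f -> sqint h ->
  ip h (fun x => a * f x) = a * ip h f.
Proof. by move=> *; rewrite ipC ipZl// ipC. Qed.

Lemma ipBr (f g h : T -> R) : sqint f -> sqint g -> sqint h ->
  ip h (fun x => f x - g x) = ip h f - ip h g.
Proof. by move=> *; rewrite ipC ipBl// ipC [ip g _]ipC. Qed.

Lemma ip0l (f : T -> R) : ip (fun=> 0) f = 0.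
Proof.
by rewrite /ip; under eq_Rintegral do rewrite mul0r; rewrite Rintegral_cst ?mul0r.
Qed.

Lemma ip_suml (I : Type) (s : seq I) (P : pred I) (F : I -> T -> R)
    (h : T -> R) : (mu D < +oo)%E ->
  (forall i, P i -> sqint (F i)) -> sqint h ->
  ip (fun x => \sum_(i <- s | P i) F i x) h = \sum_(i <- s | P i) ip (F i) h.
Proof.
move=> muD SF Sh; elim: s => [|i s IHs].
  by rewrite big_nil; under [X in ip X]eq_fun do rewrite big_nil; exact: ip0l.
rewrite big_cons; under [X in ip X]eq_fun do rewrite big_cons.
case Pi : (P i) => //; rewrite ipDl ?IHs//; first exact: SF.
exact: sqint_sum.
Qed.

Lemma ip_ge0 (f : T -> R) : 0 <= ip f f.
Proof. by apply: Rintegral_ge0 => x _; rewrite -expr2 sqr_ge0. Qed.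

Lemma ip_subK (f g : T -> R) : sqint f -> sqint g ->
  ip (fun x => f x - g x) (fun x => f x - g x) =
  ip f f - 2 * ip f g + ip g g.
Proof.
move=> Sf Sg; have Sfg := sqintB Sf Sg.
by rewrite ipBl// !ipBr// [ip g f]ipC; ring.
Qed.

Lemma ip_addK (f g : T -> R) : sqint f -> sqint g ->
  ip (fun x => f x + g x) (fun x => f x + g x) =
  ip f f + 2 * ip f g + ip g g.
Proof.
move=> Sf Sg; have Sfg := sqintD Sf Sg.
by rewrite ipDl// !ipDr// [ip g f]ipC; ring.
Qed.

Lemma ipE (f : T -> R) : sqint f ->
  (\int[mu]_(x in D) (f x ^+ 2)%:E)%E = (ip f f)%:E.
Proof.
move=> [mf intf]; rewrite /ip /Rintegral fineK; last first.
  exact: integrable_fin_num.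
by apply: eq_integral => x _; rewrite expr2.
Qed.

Lemma ip_eq0_ae (f : T -> R) : sqint f -> ip f f = 0 ->
  {ae mu, forall x, D x -> f x = 0}.
Proof.
move=> Sf f0; have := ae_eq0_of_Rintegral_le0 mD (sqint_mul Sf Sf).
move=> /(_ (fun x _ => sqr_ge0 (f x))); rewrite -/(ip f f) f0 => /(_ (lexx 0)).
by apply: ae_imp => x h /h /eqP; rewrite mulf_eq0 orbb => /eqP.
Qed.

End SquareIntegrable.

Lemma sqint_ae_bounded d (T : measurableType d) (R : realType)
    (mu : {measure set T -> \bar R}) (D : set T) (f : T -> R) (C : R) :
  measurable D -> (mu D < +oo)%E -> measurable_fun D f ->
  {ae mu, forall x, D x -> `|f x| <= C} -> sqint mu D f.
Proof.
move=> mD muD mf fC; split=> //.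
have mf2 : measurable_fun D (fun x => (f x ^+ 2)%:E).
  by apply/measurable_EFinP; exact: measurable_funX.
apply/integrableP; split=> //.
apply: (@le_lt_trans _ _ (\int[mu]_(x in D) (C ^+ 2)%:E)%E); last first.
  by rewrite integral_cst// lte_mul_pinfty// lee_fin sqr_ge0.
apply: ae_ge0_le_integral => //.
- exact: measurableT_comp.
- by move=> x _; rewrite lee_fin sqr_ge0.
- apply: ae_imp fC => x h Dx; rewrite abse_EFin lee_fin normrX lerXn2r ?nnegrE ?h//.
  exact: le_trans (h Dx).
Qed.

(** The quadratic polynomial l |-> |f - l g|^2 is nonnegative; its minimum is at
    l = <f,g> / <g,g>. *)
Lemma ip_cauchy_schwarz d (T : measurableType d) (R : realType)
    (mu : {measure set T -> \bar R}) (D : set T) (f g : T -> R) :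
  measurable D -> sqint mu D f -> sqint mu D g ->
  ip mu D f g ^+ 2 <= ip mu D f f * ip mu D g g.
Proof.
move=> mD Sf Sg; set c := ip mu D f g; set a := ip mu D f f; set b := ip mu D g g.
have q l : 0 <= a - 2 * (l * c) + l ^+ 2 * b.
  have := ip_ge0 mu D (fun x => f x - l * g x).
  have Slg := sqintZ mD l Sg.
  rewrite (ip_subK mD)// !(ipZr mD)// (ipZl mD)//.
  by have -> : l ^+ 2 * b = l * (l * b) by ring.
have b0 : 0 <= b by exact: ip_ge0.
have a0 : 0 <= a by exact: ip_ge0.
have [bz|bz] := eqVneq b 0.
  rewrite bz mulr0; have [->|c0] := eqVneq c 0; first by rewrite expr0n.
  (* If <g,g> = 0 the polynomial is affine in l, and this l makes it equal to -1. *)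
  have := q ((a + 1) / (2 * c)); rewrite bz mulr0 addr0.
  by rewrite (_ : 2 * _ = a + 1); [lra|field].
have := q (c / b); rewrite (_ : _ + _ = a - c ^+ 2 / b); last by field.
by rewrite subr_ge0 ler_pdivrMr// lt_def bz b0.
Qed.

(** Expand the integral of w (f - g)^2.  The weight w is kept on one factor only, so
    that the right-hand sides are pairings that weak convergence controls. *)
Lemma ip_young d (T : measurableType d) (R : realType)
    (mu : {measure set T -> \bar R}) (D : set T) (f g w : T -> R) :
  measurable D -> sqint mu D f -> sqint mu D g ->
  measurable_fun D w -> (forall x, 0 <= w x) -> (forall x, `|w x| <= 1) ->
  2 * ip mu D f (fun x => g x * w x) <=
    ip mu D f (fun x => f x * w x) + ip mu D g (fun x => g x * w x).
Proof.
move=> mD Lf Lg mw w0 w1.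
have Lw h : sqint mu D h -> sqint mu D (fun x => h x * w x).
  by move=> Lh; apply: (sqint_bmul mD Lh mw (C := 1)) => x _.
have : 0 <= ip mu D (fun x => f x - g x) (fun x => f x * w x - g x * w x).
  by apply: Rintegral_ge0 => x _; rewrite -mulrBl mulrA -expr2 mulr_ge0 ?sqr_ge0.
have Lfw := Lw _ Lf; have Lgw := Lw _ Lg.
rewrite (ipBl mD Lf Lg (sqintB mD Lfw Lgw)) (ipBr mD Lfw Lgw Lf) (ipBr mD Lfw Lgw Lg).
have -> : ip mu D g (fun x => f x * w x) = ip mu D f (fun x => g x * w x).
  by apply: eq_Rintegral => x _; rewrite mulrCA mulrA mulrAC -mulrA.
set x := ip mu D f _; set y := ip mu D f _; set z := ip mu D g _.
by move=> h; lra.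
Qed.

(** * Powers converging to an indicator *)

Section PowerIndicator.
Context {R : realType}.
Implicit Types (q x : R) (n m : nat).

(** Bernoulli's inequality (1 + x)^m >= 1 + m x together with (1 - x)(1 + x) <= 1.
    It shows that (1 - x)^m is small as soon as m x is large. *)
Lemma expr_le_hyperbolic x m : 0 <= x <= 1 ->
  (1 - x) ^+ m * (1 + m%:R * x) <= 1.
Proof.
move=> /andP[x0 x1]; elim: m => [|m IHm]; first by rewrite expr0 mul0r addr0 mulr1.
apply: le_trans IHm; rewrite exprSr -mulrA ler_wpM2l ?exprn_ge0 ?subr_ge0//.
have m0 : (0 : R) <= m%:R by [].
by rewrite -natr1; nra.
Qed.

Lemma bernoulli_le x m : 0 <= x <= 1 -> 1 - m%:R * x <= (1 - x) ^+ m.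
Proof.
move=> /andP[x0 x1]; elim: m => [|m IHm]; first by rewrite expr0 mul0r subr0.
rewrite exprSr; have m0 : (0 : R) <= m%:R by [].
have := @ler_wpM2r _ (1 - x) _ _ _ IHm; rewrite subr_ge0 => /(_ x1).
by apply: le_trans; rewrite -natr1; nra.
Qed.

Lemma cvg_le_harmonic (u : nat -> R) (l C : R) :
  (forall n, `|u n - l| <= C * n.+1%:R^-1) -> u n @[n --> \oo] --> l.
Proof.
move=> uC; apply/subr_cvg0.
have Ch : C * n.+1%:R^-1 @[n --> \oo] --> (0 : R).
  by rewrite -(mulr0 C); apply: cvgM; [exact: cvg_cst|exact: cvg_harmonic].
have NCh : - (C * n.+1%:R^-1) @[n --> \oo] --> (0 : R).
  by rewrite -oppr0; exact: cvgN.
apply: squeeze_cvgr NCh Ch.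
by apply: nearW => n; rewrite -ler_norml.
Qed.

(** For q < 1/2, Bernoulli bounds the distance to 1 by n (2 q)^n, which tends to 0;
    for q >= 1/2, the hyperbolic bound with x = 2^(-n) gives at most 1 / (n + 1).  The
    exponent n 2^n is chosen so that both hold at once, the value q = 1/2 included. *)
Lemma cvg_kuhn q : 0 <= q <= 1 ->
  (1 - q ^+ n) ^+ (n * 2 ^ n) @[n --> \oo] --> ((q < 2^-1)%R%:R : R).
Proof.
move=> /andP[q0 q1].
have qn n : 0 <= q ^+ n <= 1 by rewrite exprn_ge0//= exprn_ile1.
have p01 n m : 0 <= (1 - q ^+ n) ^+ m <= 1.
  have /andP[a b] := qn n.
  by rewrite exprn_ge0 ?exprn_ile1 ?subr_ge0// lerBlDr lerDl.
case: ltP => hq.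
  (* To bound n (2 q)^n by C / (n + 1), write 2 q = r^2 and bound (n + 1) r^n
     by 1 / (1 - r). *)
  pose r := Num.sqrt (2 * q).
  have r0 : 0 <= r by exact: sqrtr_ge0.
  have rE : r ^+ 2 = 2 * q by rewrite sqr_sqrtr ?mulr_ge0.
  have r1 : r < 1 by rewrite -(@ltr_pXn2r _ 2)// ?nnegrE// rE expr1n; lra.
  apply: (@cvg_le_harmonic _ _ (((1 - r) ^-1) ^+ 2)) => n.
  have -> : `|(1 - q ^+ n) ^+ (n * 2 ^ n) - 1| = 1 - (1 - q ^+ n) ^+ (n * 2 ^ n).
    by have /andP[_ ?] := p01 n (n * 2 ^ n)%N; rewrite ler0_norm ?opprB// subr_le0.
  have bern : 1 - (1 - q ^+ n) ^+ (n * 2 ^ n) <= (n * 2 ^ n)%:R * q ^+ n.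
    by rewrite lerBlDr -lerBlDl; exact: bernoulli_le.
  apply: (le_trans bern); rewrite natrM natrX -mulrA -exprMn -rE exprAC.
  have h1 : n.+1%:R * r ^+ n <= (1 - r)^-1.
    rewrite -[leRHS]mul1r ler_pdivlMr ?subr_gt0//.
    have r01 : 0 <= 1 - r <= 1 by rewrite subr_ge0 (ltW r1) lerBlDr lerDl.
    apply: le_trans (expr_le_hyperbolic n r01); rewrite subKr.
    rewrite [_ * r ^+ n]mulrC -mulrA ler_wpM2l ?exprn_ge0//.
    by rewrite -natr1; have : (0 : R) <= n%:R by []; nra.
  rewrite ler_pdivlMr// [_ * _]mulrC.
  have h2 : (n.+1%:R * r ^+ n) ^+ 2 <= (1 - r)^-1 ^+ 2.
    by rewrite lerXn2r ?nnegrE ?mulr_ge0 ?exprn_ge0 ?invr_ge0// subr_ge0 ltW.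
  apply: le_trans h2; rewrite exprMn expr2 -mulrA ler_wpM2l//.
  by rewrite ler_wpM2r ?sqr_ge0 ?exprn_ge0// ler_nat.
apply: (@cvg_le_harmonic _ _ 1) => n; rewrite subr0 mul1r.
have /andP[p0 _] := p01 n (n * 2 ^ n)%N; rewrite ger0_norm//.
have h01 : 0 <= (2^-1 : R) ^+ n <= 1 .
  by apply/andP; split; [exact: exprn_ge0|rewrite exprn_ile1// invf_le1// ler1n].
have := @expr_le_hyperbolic ((2^-1 : R) ^+ n) (n * 2 ^ n)%N h01.
rewrite natrM natrX -mulrA -exprMn mulfV// expr1n mulr1 nat1r => h.
rewrite -[leRHS]mul1r ler_pdivlMr//; apply: le_trans h.
rewrite ler_wpM2r// lerXn2r ?nnegrE ?subr_ge0//.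
- by have /andP[] := qn n.
- by have /andP[] := h01.
- by rewrite lerB// lerXn2r// nnegrE// invr_ge0.
Qed.

End PowerIndicator.

(** * Density of an algebra of bounded functions *)

Section SquareIntegrableLimits.
Context d (T : measurableType d) (R : realType).
Variables (mu : {measure set T -> \bar R}) (D : set T) (mD : measurable D).

Lemma ip_addK_le (f g : T -> R) : sqint mu D f -> sqint mu D g ->
  ip mu D (fun x => f x + g x) (fun x => f x + g x) <=
  2 * ip mu D f f + 2 * ip mu D g g.
Proof.
move=> Sf Sg; have := ip_ge0 mu D (fun x => f x - g x).
rewrite ip_subK// ipDl ?ipDr ?(ipC mu D g f)//; try exact: sqintD.
by lra.
Qed.

(** Dominated convergence for |fn - f|^2, which is at most 2 g^2 + 2 f^2. *)
Lemma cvg_ip_dominated (fn : nat -> T -> R) (f g : T -> R) :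
  (forall n, measurable_fun D (fn n)) -> sqint mu D f -> sqint mu D g ->
  (forall n x, D x -> `|fn n x| <= g x) ->
  {ae mu, forall x, D x -> fn n x @[n --> \oo] --> f x} ->
  ip mu D (fun x => fn n x - f x) (fun x => fn n x - f x)
    @[n --> \oo] --> 0.
Proof.
move=> mfn Sf Sg fng fnf.
pose F n x : \bar R := ((fn n x - f x) ^+ 2)%:E.
pose G x : \bar R := (2 * g x ^+ 2 + 2 * f x ^+ 2)%:E.
have mf := Sf.1.
have mF n : measurable_fun D (F n).
  by apply/measurable_EFinP/measurable_funX; exact: measurable_funB.
have Fcvg : {ae mu, forall x, D x -> F n x @[n --> \oo] --> (cst 0%E : T -> \bar R) x}.
  apply: filterS fnf => x /= h Dx; apply: cvg_EFin; first exact: nearW.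
  have h0 : fn n x - f x @[n --> \oo] --> (0 : R).
    by rewrite -(subrr (f x)); apply: cvgB; [exact: h|exact: cvg_cst].
  have hh : (fn n x - f x) * (fn n x - f x) @[n --> \oo] --> (0 : R).
    by rewrite -(mulr0 0); exact: cvgM.
  by apply: cvg_trans hh; apply: near_eq_cvg; apply: nearW => n /=; rewrite expr2.
have iG : mu.-integrable D G.
  apply: eq_integrable (integrableD mD (integrableZl mD 2 Sg.2)
    (integrableZl mD 2 Sf.2)) => // x _ /=.
have FG : {ae mu, forall x n, D x -> (`|F n x| <= G x)%E}.
  apply: aeW => x n Dx; rewrite /F /G abse_EFin lee_fin ger0_norm ?sqr_ge0//.
  have h1 := fng n x Dx; have h2 := sqr_ge0 (fn n x + f x).
  have : fn n x ^+ 2 <= g x ^+ 2.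
    rewrite -[leLHS]real_normK ?num_real// lerXn2r// nnegrE.
    exact: le_trans h1.
  by nra.
have [_ _] := dominated_convergence mD mF (measurable_cst _) Fcvg iG FG.
rewrite integral_cst// mul0e => /fine_cvg/=.
apply: cvg_trans; apply: near_eq_cvg; apply: nearW => n /=.
by rewrite /ip /Rintegral /F; under eq_integral do rewrite expr2.
Qed.

End SquareIntegrableLimits.

Section Density.
Context d (T : measurableType d) (R : realType).
Variables (mu : {measure set T -> \bar R}) (D : set T).
Hypotheses (mD : measurable D) (muD : (mu D < +oo)%E).
Variable Alg : set (T -> R).
Hypothesis Alg_cst : forall a, Alg (fun=> a).
Hypothesis AlgD : forall f g, Alg f -> Alg g -> Alg (fun x => f x + g x).
Hypothesis AlgM : forall f g, Alg f -> Alg g -> Alg (fun x => f x * g x).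
Hypothesis Alg_measurable : forall f, Alg f -> measurable_fun D f.
Hypothesis Alg_bounded : forall f, Alg f -> exists C : R, forall x, `|f x| <= C.

Let AlgX f n : Alg f -> Alg (fun x => f x ^+ n).
Proof.
move=> Af; elim: n => [|n IHn]; first exact: Alg_cst.
by under eq_fun do rewrite exprS; exact: AlgM.
Qed.

Let AlgB1 f : Alg f -> Alg (fun x => 1 - f x).
Proof.
move=> Af; have := AlgD (Alg_cst 1) (AlgM (Alg_cst (-1)) Af).
by under [in X in X -> _]eq_fun do rewrite mulN1r.
Qed.

Let Alg_sqint f : Alg f -> sqint mu D f.
Proof.
move=> Af; have [C fC] := Alg_bounded Af.
by apply: (@sqint_bounded _ _ _ mu D mD f C) => //; exact: Alg_measurable.
Qed.

(** Limits are taken with a uniform bound so that dominated convergence turns them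
    into limits in L^2, and so that the notion is stable under intersections. *)
Definition indic_limit (S : set T) : Prop :=
  exists p : nat -> T -> R, [/\ forall n, Alg (p n), forall n x, `|p n x| <= 1
    & {ae mu, forall x, D x -> p n x @[n --> \oo] --> (\1_S x : R)}].

(** Rescale f into q with values in [0,1] so that f > 0 means q < 1/2, and apply
    [cvg_kuhn] to q: polynomials in f stay in the algebra. *)
Lemma indic_limit_gt0 (f : T -> R) (S : set T) : Alg f ->
  {ae mu, forall x, D x -> (x \in S) = (0 < f x)} -> indic_limit S.
Proof.
move=> Af fS; have [C fC] := Alg_bounded Af.
pose K := `|C| + 1; have K0 : 0 < K by rewrite ltr_wpDl.
pose q x := 2^-1 + (- (2 * K)^-1) * f x.
have Aq : Alg q by apply: AlgD => //; apply: AlgM.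
have fK x : `|f x / K| <= 1.
  rewrite normrM [X in _ * X]gtr0_norm ?invr_gt0// ler_pdivrMr// mul1r.
  by rewrite (le_trans (fC x))// (le_trans (ler_norm _))// lerDl.
have qE x : q x = 2^-1 * (1 - f x / K).
  by rewrite /q invfM; field; rewrite gt_eqF.
have q01 x : 0 <= q x <= 1.
  by have := fK x; rewrite ler_norml qE => /andP[? ?]; apply/andP; split; lra.
exists (fun n x => (1 - q x ^+ n) ^+ (n * 2 ^ n)); split.
- by move=> n; apply/AlgX/AlgB1/AlgX.
- move=> n x; have /andP[q0 q1] := q01 x.
  have : q x ^+ n <= 1 by rewrite exprn_ile1.
  have : 0 <= q x ^+ n by rewrite exprn_ge0.
  move=> h1 h2; rewrite ger0_norm ?exprn_ge0 ?subr_ge0//.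
  by rewrite exprn_ile1 ?subr_ge0// lerBlDr lerDl.
- apply: filterS fS => x /= fSx Dx; rewrite indicE fSx//.
  have -> : (0 < f x) = (q x < 2^-1); last exact: cvg_kuhn.
  by rewrite /q gtrDl mulNr oppr_lt0 pmulr_rgt0// invr_gt0 mulr_gt0.
Qed.

Lemma indic_limitT : indic_limit setT.
Proof.
exists (fun _ _ => 1); split=> [n|n x|]; first exact: Alg_cst.
  by rewrite normr1.
by apply: aeW => x _; rewrite indicT; exact: cvg_cst.
Qed.

Lemma indic_limitI (S S' : set T) : indic_limit S -> indic_limit S' ->
  indic_limit (S `&` S').
Proof.
move=> [p [Ap p1 pS]] [p' [Ap' p'1 p'S]].
exists (fun n x => p n x * p' n x); split.
- by move=> n; exact: AlgM.
- by move=> n x; rewrite normrM mulr_ile1.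
- apply: filterS2 pS p'S => x h h' Dx; rewrite indicI.
  by apply: cvgM; [exact: h|exact: h'].
Qed.

Definition L2_closure (f : T -> R) : Prop := sqint mu D f /\
  forall e : R, 0 < e ->
    exists2 p, Alg p & ip mu D (fun x => f x - p x) (fun x => f x - p x) < e.

Lemma L2_closure_Alg f : Alg f -> L2_closure f.
Proof.
move=> Af; split=> [|e e0]; first exact: Alg_sqint.
exists f => //; rewrite /ip; under eq_Rintegral do rewrite subrr mul0r.
by rewrite Rintegral_cst// mul0r.
Qed.

(** The closure is closed: |f - p|^2 <= 2 |f - g|^2 + 2 |g - p|^2. *)
Lemma L2_closure_lim f : sqint mu D f ->
  (forall e : R, 0 < e -> exists2 g, L2_closure g &
     ip mu D (fun x => g x - f x) (fun x => g x - f x) < e) ->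
  L2_closure f.
Proof.
move=> Sf fg; split=> // e e0.
have e4 : 0 < e / 4 by rewrite divr_gt0.
have [g [Sg clg] gf] := fg _ e4.
have [p Ap pg] := clg _ e4; exists p => //.
have Sp := Alg_sqint Ap.
have := ip_addK_le mD (sqintZ mD (-1) (sqintB mD Sg Sf)) (sqintB mD Sg Sp).
rewrite (@eq_ip _ _ _ _ _ _ (fun x => f x - p x) _ (fun x => f x - p x));
  try by move=> x _; ring.
rewrite ipZl ?ipZr//; try exact: sqintB; try by apply: sqintZ => //; exact: sqintB.
by move=> h; apply: le_lt_trans h _; lra.
Qed.

Lemma L2_closureD f g : L2_closure f -> L2_closure g ->
  L2_closure (fun x => f x + g x).
Proof.
move=> [Sf clf] [Sg clg]; split=> [|e e0]; first exact: sqintD.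
have e4 : 0 < e / 4 by rewrite divr_gt0.
have [p Ap pf] := clf _ e4; have [q Aq qg] := clg _ e4.
exists (fun x => p x + q x); first exact: AlgD.
have := ip_addK_le mD (sqintB mD Sf (Alg_sqint Ap)) (sqintB mD Sg (Alg_sqint Aq)).
rewrite (@eq_ip _ _ _ _ _ _ (fun x => f x + g x - (p x + q x)) _
  (fun x => f x + g x - (p x + q x))) => [h|x _|x _]; try by ring.
by apply: le_lt_trans h _; lra.
Qed.

Lemma L2_closureZ a f : L2_closure f -> L2_closure (fun x => a * f x).
Proof.
move=> [Sf clf]; split=> [|e e0]; first exact: sqintZ.
have a0 : 0 < a ^+ 2 + 1 by rewrite ltr_wpDl ?sqr_ge0.
have [p Ap pf] := clf (e / (a ^+ 2 + 1)) (divr_gt0 e0 a0).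
exists (fun x => a * p x); first exact: AlgM.
have Sfp := sqintB mD Sf (Alg_sqint Ap).
rewrite (@eq_ip _ _ _ _ _ _ (fun x => a * (f x - p x)) _
  (fun x => a * (f x - p x))) => [|x _|x _]; try by rewrite mulrBr.
rewrite ipZl ?ipZr//; last exact: sqintZ.
rewrite mulrA -expr2; move: pf; rewrite ltr_pdivlMr// mulrC; apply: le_lt_trans.
by rewrite ler_wpM2r ?ip_ge0// lerDl.
Qed.

Lemma L2_closure_cvg (fn : nat -> T -> R) (f g : T -> R) :
  (forall n, L2_closure (fn n)) -> sqint mu D f -> sqint mu D g ->
  (forall n x, D x -> `|fn n x| <= g x) ->
  {ae mu, forall x, D x -> fn n x @[n --> \oo] --> f x} -> L2_closure f.
Proof.
move=> clfn Sf Sg fng fnf; apply: L2_closure_lim => // e e0.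
have := @cvg_ip_dominated _ _ _ mu D mD fn f g (fun n => (clfn n).1.1) Sf Sg fng fnf.
move/cvgr0Pnorm_lt => /(_ _ e0) [N _ /(_ N (leqnn N))/= h].
by exists (fn N) => //; move: h; rewrite ger0_norm// ip_ge0.
Qed.

Let measurable_indicD (S : set T) : measurable S ->
  measurable_fun D (\1_S : T -> R).
Proof. by move=> mS; exact: measurable_indic. Qed.

Let sqint_indic (S : set T) : measurable S -> sqint mu D (\1_S : T -> R).
Proof.
move=> mS; apply: (@sqint_bounded _ _ _ mu D mD _ 1) => [//||x _].
  exact: measurable_indicD.
by rewrite indicE; case: (_ \in _); rewrite ?normr1 ?normr0.
Qed.

Lemma L2_closure_indic_limit (S : set T) : measurable S -> indic_limit S ->
  L2_closure (\1_S).
Proof.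
move=> mS [p [Ap p1 pS]].
apply: (@L2_closure_cvg p _ (cst 1)) => //.
- by move=> n; exact: L2_closure_Alg.
- exact: sqint_indic.
- exact: sqint_cst.
Qed.

Variable G : set (set T).
Hypothesis G_measurable : @measurable _ T = <<s G >>.
Hypothesis GI : setI_closed G.
Hypothesis G_limit : G `<=` indic_limit.

(** The sets whose indicator lies in the closure form a Dynkin system: complements
    are differences with the constant 1, and disjoint unions are bounded limits of finite sums.
    It contains the generating family G, which is stable under intersection. *)
Lemma L2_closure_indic (S : set T) : measurable S -> L2_closure (\1_S).
Proof.
rewrite G_measurable; move: S.
apply: (dynkin_induction G_measurable GI).
- by apply: L2_closure_Alg; rewrite indicT; exact: Alg_cst.
- move=> S GS; apply: L2_closure_indic_limit; last exact: G_limit.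
  by rewrite G_measurable; exact: sub_gen_smallest.
- move=> S mS clS.
  have := L2_closureD (L2_closure_Alg (Alg_cst 1)) (L2_closureZ (-1) clS).
  suff -> : (\1_(~` S) : T -> R) = (fun x => 1 + -1 * \1_S x) by [].
  by apply/funext => x; rewrite !indicE in_setC; case: (x \in S) => /=; ring.
- move=> F mF tF clF.
  have clU n : L2_closure (fun x => \sum_(k < n) \1_(F k) x).
    elim: n => [|n IHn].
      by under eq_fun do rewrite big_ord0; exact: L2_closure_Alg.
    by under eq_fun do rewrite big_ord_recr/=; exact: L2_closureD.
  have Fmem x k : F k x -> \1_(\bigcup_k F k) x = 1 :> R.
    by move=> Fkx; rewrite indicE mem_set//; exists k.
  have sumF x k n : F k x -> \sum_(i < n) \1_(F i) x = (k < n)%N%:R :> R.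
    move=> Fkx; elim: n => [|n IHn]; first by rewrite big_ord0.
    have nF : k != n -> (x \in F n) = false.
      move=> /eqP kn; rewrite memNset// => Fnx; apply: kn.
      by apply: tF => //; exists x.
    rewrite big_ord_recr/= IHn indicE ltnS.
    case: (ltngtP k n) => [kn|nk|<-]; rewrite ?nF ?addr0 ?mem_set ?add0r//.
      by rewrite neq_ltn kn.
    by rewrite neq_ltn nk orbT.
  have sum0 x n : ~ (\bigcup_k F k) x -> \sum_(i < n) \1_(F i) x = 0 :> R.
    move=> nFx; apply: big1 => i _; rewrite indicE memNset// => Fix; apply: nFx.
    by exists (nat_of_ord i).
  apply: (@L2_closure_cvg (fun n x => \sum_(k < n) \1_(F k) x) _ (cst 1)) => //.
  + by apply: sqint_indic; exact: bigcup_measurable.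
  + exact: sqint_cst.
  + move=> n x _ /=; have [[k _ Fkx]|/sum0->] := pselect ((\bigcup_k F k) x).
      by rewrite (sumF _ _ _ Fkx); case: (_ < _)%N; rewrite ?normr1 ?normr0.
    by rewrite normr0.
  + apply: aeW => x _; have [[k _ Fkx]|nFx] := pselect ((\bigcup_k F k) x).
      rewrite (Fmem _ _ Fkx); apply: (@cvg_near_cst _ _ _ _ _ _ _).
      by exists k.+1 => // n /= kn; rewrite (sumF _ _ _ Fkx) kn.
    rewrite indicE memNset//; under eq_fun do rewrite sum0//.
    exact: cvg_cst.
Qed.

Import HBNNSimple HBSimple.

Lemma L2_closure_nnsfun (g : {nnsfun T >-> R}) : L2_closure g.
Proof.
have clS n (a : nat -> R) (S : nat -> set T) : (forall i, measurable (S i)) ->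
    L2_closure (fun x => \sum_(i < n) a i * \1_(S i) x).
  move=> mS; elim: n => [|n IHn].
    by under eq_fun do rewrite big_ord0; exact: L2_closure_Alg.
  under eq_fun do rewrite big_ord_recr/=; apply: L2_closureD => //.
  by apply: L2_closureZ; exact: L2_closure_indic.
rewrite (funext (fimfunEord g)).
by apply: (clS _ (nth 0 _) (fun i => g @^-1` [set nth 0 _ i])).
Qed.

Lemma L2_closure_ge0 (f : T -> R) : sqint mu D f -> (forall x, D x -> 0 <= f x) ->
  L2_closure f.
Proof.
move=> Sf f0; have mf : measurable_fun D (EFin \o f).
  by apply/measurable_EFinP; exact: Sf.1.
have f0' x : D x -> (0 <= (EFin \o f) x)%E by move=> Dx; rewrite lee_fin f0.
have cvgf x (Dx : D x) := cvg_nnsfun_approx mD mf f0' Dx.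
apply: (@L2_closure_cvg (fun n => nnsfun_approx mD mf n : T -> R) f f) => //.
- by move=> n; exact: L2_closure_nnsfun.
- move=> n x Dx; rewrite ger0_norm// -lee_fin.
  have cx : nnsfun_approx mD mf n x @[n --> \oo] --> f x.
    exact: fine_cvg (cvgf x Dx).
  have nd : nondecreasing_seq (fun n => nnsfun_approx mD mf n x).
    by move=> m1 m2 m12; have /lefP := nd_nnsfun_approx mD mf m12; exact.
  by have := nondecreasing_cvgn_le nd (cvgP _ cx) n; rewrite (cvg_lim _ cx).
- by apply: aeW => x Dx; exact: fine_cvg (cvgf x Dx).
Qed.

(** Simple functions are combinations of indicators, nonnegative functions are
    increasing limits of simple functions, and f is the difference of (|f| + f) / 2 and
    (|f| - f) / 2. *)
Lemma L2_dense (f : T -> R) : sqint mu D f -> L2_closure f.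
Proof.
move=> Sf; have Sn : sqint mu D (fun x => `|f x|).
  split; first by apply: measurableT_comp => //; exact: Sf.1.
  by apply: eq_integrable Sf.2 => // x _; rewrite real_normK ?num_real.
have Sp := sqintZ mD 2^-1 (sqintD mD Sn Sf).
have Sm := sqintZ mD 2^-1 (sqintB mD Sn Sf).
have {}Sp := L2_closure_ge0 Sp _; have {}Sm := L2_closure_ge0 Sm _.
rewrite (_ : f = fun x => 2^-1 * (`|f x| + f x) + -1 * (2^-1 * (`|f x| - f x))).
  apply: L2_closureD; last apply: L2_closureZ.
    by apply: Sp => x _; rewrite mulr_ge0// -lerBlDr sub0r -normrN ler_norm.
  by apply: Sm => x _; rewrite mulr_ge0// subr_ge0 ler_norm.
by apply/funext => x; field.
Qed.

End Density.

Notation I01 := (`[0%R, 1%R]%classic).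

(** * Trigonometric polynomials *)

Section TrigonometricPolynomials.
Context {R : realType} {T : Type} {I : zmodType}.
Variable ph : I -> T -> R.

(** Real trigonometric polynomials for an abstract additive family of phases.  It
    is used on [0,1], on the torus and on space-time; the phase shift b covers sines, and makes
    the class stable under products and derivatives. *)
Inductive trigpoly : (T -> R) -> Prop :=
| trigpoly_cos a k b : trigpoly (fun x => a * cos (ph k x + b))
| trigpolyD f g : trigpoly f -> trigpoly g -> trigpoly (fun x => f x + g x).

Hypothesis phD : forall k l x, ph (k + l) x = ph k x + ph l x.

Lemma phase0 x : ph 0 x = 0.
Proof. by apply: (addrI (ph 0 x)); rewrite -phD !addr0. Qed.

Lemma phaseN k x : ph (- k) x = - ph k x.
Proof. by apply: (addrI (ph k x)); rewrite -phD !subrr phase0. Qed.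

Lemma phaseB k l x : ph (k - l) x = ph k x - ph l x.
Proof. by rewrite phD phaseN. Qed.

Lemma cosMcos (u v : R) : cos u * cos v = 2^-1 * (cos (u + v) + cos (u - v)).
Proof. by rewrite cosD cosB; field. Qed.

Lemma trigpoly_cst a : trigpoly (fun=> a).
Proof.
have := trigpoly_cos a 0 0.
by under [in X in X -> _]eq_fun do rewrite phase0 addr0 cos0 mulr1.
Qed.

Lemma trigpolyM f g : trigpoly f -> trigpoly g -> trigpoly (fun x => f x * g x).
Proof.
elim=> [a k b|f1 f2 _ IH1 _ IH2] Tg; last first.
  by under eq_fun do rewrite mulrDl; right; [exact: IH1|exact: IH2].
elim: Tg => [c l e|g1 g2 _ IH1 _ IH2]; last first.
  by under eq_fun do rewrite mulrDr; right.
suff -> : (fun x => a * cos (ph k x + b) * (c * cos (ph l x + e))) =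
    (fun x => (2^-1 * a * c) * cos (ph (k + l) x + (b + e)) +
              (2^-1 * a * c) * cos (ph (k - l) x + (b - e))).
  by right; left.
apply/funext => x; rewrite mulrACA cosMcos.
have -> : ph k x + b + (ph l x + e) = ph (k + l) x + (b + e) by rewrite phD; ring.
have -> : ph k x + b - (ph l x + e) = ph (k - l) x + (b - e) by rewrite phaseB; ring.
by ring.
Qed.

Lemma trigpoly_bounded f : trigpoly f -> exists C : R, forall x, `|f x| <= C.
Proof.
elim=> [a k b|f1 f2 _ [C1 h1] _ [C2 h2]].
  exists `|a| => x; rewrite normrM -[leRHS]mulr1 ler_wpM2l// ler_norml.
  by rewrite cos_geN1 cos_le1.
by exists (C1 + C2) => x; apply: le_trans (ler_normD _ _) _; exact: lerD.
Qed.

End TrigonometricPolynomials.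

Lemma measurable_trigpoly d (T : measurableType d) (R : realType) (I : zmodType)
  (ph : I -> T -> R) (D : set T) (f : T -> R) :
  (forall k, measurable_fun D (ph k)) -> trigpoly ph f -> measurable_fun D f.
Proof.
move=> mph; elim=> [a k b|f1 f2 _ m1 _ m2]; last exact: measurable_funD.
apply: measurable_funM; first exact: measurable_cst.
apply: measurableT_comp; last by apply: measurable_funD => //.
by apply: continuous_measurable_fun; exact: continuous_cos.
Qed.

Lemma sqint_trigpoly d (T : measurableType d) (R : realType) (I : zmodType)
    (ph : I -> T -> R) (mu : {measure set T -> \bar R}) (D : set T) (f : T -> R) :
  measurable D -> (mu D < +oo)%E -> (forall k, measurable_fun D (ph k)) ->
  trigpoly ph f -> sqint mu D f.
Proof.
move=> mD muD mph Tf; have [C fC] := trigpoly_bounded Tf.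
apply: (@sqint_bounded _ _ _ _ _ mD f C muD) => [|x _]; last exact: fC.
exact: measurable_trigpoly mph Tf.
Qed.

Section Rays.
Context {R : realType}.

(** The difference is 2 sin u sin (v - u) with u = pi x / L and v = pi b / L; since u
    lies in ]0, pi[, its sign is that of v - u.  This identifies a ray, within a period, with the set
    where a trigonometric polynomial is positive. *)
Lemma sub_cos_gt0 (L b x : R) : 0 < x < L -> 0 < b < L ->
  (0 < cos (2 * pi / L * x - pi * b / L) - cos (pi * b / L)) = (x < b).
Proof.
move=> /andP[x0 xL] /andP[b0 bL].
have L0 : 0 < L by exact: lt_trans xL.
pose u := pi * x / L; pose v := pi * b / L.
have uv (w z : R) : (pi * w / L < pi * z / L) = (w < z).
  by rewrite -!mulrA ltr_pM2l ?pi_gt0// ltr_pM2r// invr_gt0.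
have u0 : 0 < u by have := uv 0 x; rewrite mulr0 mul0r x0.
have v0 : 0 < v by have := uv 0 b; rewrite mulr0 mul0r b0.
have piL : pi * L / L = pi by rewrite mulfK// gt_eqF.
have up : u < pi by rewrite -[ltRHS]piL uv.
have vp : v < pi by rewrite -[ltRHS]piL uv.
have -> : cos (2 * pi / L * x - pi * b / L) - cos (pi * b / L) =
    2 * (sin u * sin (v - u)).
  have -> : 2 * pi / L * x - pi * b / L = u - (v - u).
    by rewrite /u /v; field; rewrite gt_eqF.
  have -> : cos (pi * b / L) = cos (u + (v - u)) by rewrite addrC subrK.
  by move: (v - u) => w; rewrite cosB cosD; ring.
have su : 0 < sin u by rewrite sin_gt0_pi// u0.
rewrite pmulr_rgt0// pmulr_rgt0// -uv -/u -/v.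
case: (ltgtP u v) => [h|h|->].
- by rewrite sin_gt0_pi// subr_gt0 h/= ltrBlDr (lt_trans vp)// ltrDl.
- apply/negbTE; rewrite -leNgt -opprB sinN oppr_le0 ltW// sin_gt0_pi//.
  by rewrite subr_gt0 h/= ltrBlDr (lt_trans up)// ltrDl.
- by rewrite subrr sin0 ltxx.
Qed.

Context d (T : measurableType d) (mu : {measure set T -> \bar R}) (D : set T).

(** [sub_cos_gt0] and [indic_limit_gt0]; rays whose end lies outside ]0, L[ are,
    up to the excluded values of c, everything or nothing. *)
Lemma indic_limit_ray (Alg : set (T -> R)) (c : T -> R) (L : R) :
  (forall a, Alg (fun=> a)) ->
  (forall f g, Alg f -> Alg g -> Alg (fun x => f x + g x)) ->
  (forall f g, Alg f -> Alg g -> Alg (fun x => f x * g x)) ->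
  (forall f, Alg f -> exists C : R, forall x, `|f x| <= C) ->
  (forall b, Alg (fun x => cos (2 * pi / L * c x + b))) ->
  {ae mu, forall x, D x -> 0 < c x < L} ->
  forall b, indic_limit mu D Alg (c @^-1` `]-oo, b[).
Proof.
move=> A1 AD AM Ab Ac cL b.
have [b0|b0] := leP b 0.
  apply: (indic_limit_gt0 A1 AD AM Ab (f := cst 0)); first exact: A1.
  apply: filterS cL => x /= h Dx.
  rewrite ltxx memNset// /= in_itv/=; apply/negP; rewrite -leNgt.
  by have /andP[/ltW/(le_trans b0)] := h Dx.
have [bL|bL] := leP L b.
  apply: (indic_limit_gt0 A1 AD AM Ab (f := cst 1)); first exact: A1.
  apply: filterS cL => x /= h Dx.
  rewrite ltr01 mem_set// /= in_itv/=.
  by have /andP[_ /lt_le_trans] := h Dx; apply.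
apply: (indic_limit_gt0 A1 AD AM Ab
    (f := fun x => cos (2 * pi / L * c x - pi * b / L) - cos (pi * b / L))).
  exact: AD.
apply: filterS cL => x /= h Dx; rewrite sub_cos_gt0 ?h ?b0//.
by apply/idP/idP; rewrite inE/= in_itv.
Qed.

End Rays.

Section Dense1D.
Context {R : realType}.

Definition phase1 (n : int) (t : R) : R := 2 * pi * n%:~R * t.

Lemma phase1D (m n : int) t : phase1 (m + n) t = phase1 m t + phase1 n t.
Proof. by rewrite /phase1 intrD mulrDr mulrDl. Qed.

Lemma measurable_phase1 (D : set R) n : measurable_fun D (phase1 n).
Proof.
by apply: measurable_funTS; apply: measurable_funM; [exact: measurable_cst|exact: measurable_id].
Qed.

Let mD : measurable (I01 : set (measurableTypeR R)).
Proof. exact: measurable_itv. Qed.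

Lemma leb1_itv01 : @leb1 R I01 = 1%E.
Proof. by rewrite /leb1 /= lebesgue_measure_itv/= lte01 oppr0 adde0. Qed.

Lemma negligible_set1 (a : R) : (@leb1 R).-negligible [set a].
Proof. by exists [set a]; split; [exact: measurable_set1|exact: lebesgue_measure_set1|]. Qed.

Lemma ae_itv01 : {ae @leb1 R, forall t, (I01 : set R) t -> 0 < t < 1}.
Proof.
apply: negligibleS (negligibleU (negligible_set1 0) (negligible_set1 1)).
move=> t /= /not_implyP[]; rewrite /= in_itv/= => /andP[t0 t1] /negP.
by rewrite !lt_neqAle t0 t1 !andbT negb_and !negbK => /orP[/eqP<-|/eqP->]; [left|right].
Qed.

Lemma dense_trigpoly1 (f : R -> R) :
  sqint (@leb1 R) I01 f ->
  L2_closure (@leb1 R) I01 (trigpoly phase1) f.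
Proof.
move=> Sf.
have mu1 : (@leb1 R I01 < +oo)%E by rewrite leb1_itv01 ltry.
apply: (@L2_dense _ _ _ _ _ mD mu1 _ _ _ _ _ _ (@RGenInftyO.G R)) => //.
- exact: trigpoly_cst phase1D.
- exact: trigpolyD.
- exact: trigpolyM phase1D.
- move=> g; apply: measurable_trigpoly => n.
  by apply: measurable_funM; [exact: measurable_cst|exact: measurable_id].
- exact: trigpoly_bounded.
- exact: RGenInftyO.measurableE.
- move=> _ _ [a ->] [b ->]; exists (Num.min a b).
  by rewrite eqEsubset; split => x /=; rewrite !in_itv/= lt_min => /andP.
- move=> _ [b ->].
  suff : indic_limit (@leb1 R) I01 (trigpoly phase1) ((fun x => x) @^-1` `]-oo, b[) by [].
  apply: (@indic_limit_ray _ _ _ _ _ _ _ 1).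
  + exact: trigpoly_cst phase1D.
  + exact: trigpolyD.
  + exact: trigpolyM phase1D.
  + exact: trigpoly_bounded.
  + move=> c; have := trigpoly_cos phase1 1 1 c.
    by under [in X in X -> _]eq_fun do rewrite mul1r /phase1 mulr1 -[2 * pi]divr1.
  + exact: ae_itv01.
Qed.

End Dense1D.

(** * Fubini on a product of sets *)

Section FubiniOnProducts.
Context d1 d2 (T1 : measurableType d1) (T2 : measurableType d2) (R : realType).
Variables (m1 : {sigma_finite_measure set T1 -> \bar R}).
Variables (m2 : {sigma_finite_measure set T2 -> \bar R}).
Variables (D1 : set T1) (D2 : set T2).
Hypotheses (mD1 : measurable D1) (mD2 : measurable D2).

Let mD : measurable (D1 `*` D2). Proof. exact: measurableX. Qed.

Lemma measurable_slice1 d' (T' : measurableType d') (f : T1 * T2 -> T') x :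
  measurable_fun (D1 `*` D2) f -> D1 x -> measurable_fun D2 (fun y => f (x, y)).
Proof.
move=> mf D1x; apply: (measurable_comp (F := D1 `*` D2)) => //.
- by move=> _ [y D2y <-].
- by apply: measurable_funTS; exact: pair1_measurable.
Qed.

(** Extension by zero reduces integrals over a product of sets to
    integrals over the whole product space, where the general Fubini theorems apply. *)
Lemma integral_patch1 (f : T1 * T2 -> \bar R) x :
  (\int[m2]_y (f \_ (D1 `*` D2)) (x, y) =
  ((fun x => \int[m2]_(y in D2) f (x, y)) \_ D1) x)%E.
Proof.
rewrite [RHS]patchE; case: ifPn => D1x.
  rewrite [RHS]integral_mkcond; apply: eq_integral => y _.
  by rewrite !patchE in_setX D1x.
by apply: integral0_eq => y _; rewrite patchE in_setX (negbTE D1x).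
Qed.

Lemma integral_patch2 (f : T1 * T2 -> \bar R) y :
  (\int[m1]_x (f \_ (D1 `*` D2)) (x, y) =
  ((fun y => \int[m1]_(x in D1) f (x, y)) \_ D2) y)%E.
Proof.
rewrite [RHS]patchE; case: ifPn => D2y.
  rewrite [RHS]integral_mkcond; apply: eq_integral => x _.
  by rewrite !patchE in_setX D2y andbT.
by apply: integral0_eq => x _; rewrite patchE in_setX (negbTE D2y) andbF.
Qed.

Section Tonelli.
Variable f : T1 * T2 -> \bar R.
Hypotheses (mf : measurable_fun (D1 `*` D2) f).
Hypothesis f0 : forall z, (D1 `*` D2) z -> (0 <= f z)%E.

Let mf' : measurable_fun setT (f \_ (D1 `*` D2)).
Proof. exact/(measurable_restrictT _ mD). Qed.

Let f0' z : (0 <= (f \_ (D1 `*` D2)) z)%E.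
Proof. by rewrite patchE; case: ifPn => // /set_mem /f0. Qed.

Lemma measurable_integral_slice :
  measurable_fun D1 (fun x => \int[m2]_(y in D2) f (x, y))%E.
Proof.
have := measurable_fun_fubini_tonelli_F (m2 := m2) _ mf' f0'.
rewrite /fubini_F (funext (integral_patch1 f)) => h.
exact/(measurable_restrictT _ mD1).
Qed.

Lemma tonelli_on : (\int[m1 \x m2]_(z in D1 `*` D2) f z =
  \int[m1]_(x in D1) \int[m2]_(y in D2) f (x, y))%E.
Proof.
rewrite integral_mkcond (fubini_tonelli1 _ mf' f0') [RHS]integral_mkcond.
by apply: eq_integral => x _; rewrite -integral_patch1.
Qed.

End Tonelli.

Section Fubini.
Variable f : T1 * T2 -> R.
Hypothesis intf : (m1 \x m2)%E.-integrable (D1 `*` D2) (EFin \o f).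

Let g : T1 * T2 -> \bar R := (EFin \o f) \_ (D1 `*` D2).

Let intg : (m1 \x m2)%E.-integrable setT g.
Proof. exact/(integrable_mkcond _ mD). Qed.

Lemma ae_integrable_slice :
  {ae m1, forall x, D1 x -> m2.-integrable D2 (fun y => (f (x, y))%:E)}.
Proof.
apply: filterS (ae_integrable1 intg) => x /= h D1x.
apply/(integrable_mkcond _ mD2); apply: eq_integrable h => // y _.
by rewrite /g !patchE in_setX mem_set.
Qed.

Let measurable_fine_on d (T : measurableType d) (F : T -> \bar R) :
  measurable_fun setT F -> measurable_fun setT (fun x => fine (F x)).
Proof. by move=> mF; apply: measurableT_comp. Qed.

Let FE x : ((fun x => \int[m2]_(y in D2) f (x, y)) \_ D1) x =
  fine (fubini_F m2 g x).
Proof. by rewrite /fubini_F integral_patch1 !patchE; case: ifPn. Qed.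

Let GE y : ((fun y => \int[m1]_(x in D1) f (x, y)) \_ D2) y =
  fine (fubini_G m1 g y).
Proof. by rewrite /fubini_G integral_patch2 !patchE; case: ifPn. Qed.

Let integrable_fine d (T : measurableType d) (mu : {measure set T -> \bar R})
    (F : T -> \bar R) : mu.-integrable setT F ->
  mu.-integrable setT (fun x => (fine (F x))%:E) /\
  (\int[mu]_x (fine (F x))%:E = \int[mu]_x F x)%E.
Proof.
move=> intF; have mF := measurable_int _ intF.
have mfF : measurable_fun setT (fun x => (fine (F x))%:E).
  by apply/measurable_EFinP; exact: measurable_fine_on.
split.
  apply: (le_integrable measurableT mfF _ intF) => x _.
  by case: (F x) => [r| |] /=; rewrite ?normr0 ?leey ?lee_fin.
apply: ae_eq_integral => //; apply: filterS (integrable_ae measurableT intF).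
by move=> x /= h _; rewrite fineK//; exact: h.
Qed.

Lemma integrable_Rintegral_slice :
  m1.-integrable D1 (fun x => (\int[m2]_(y in D2) f (x, y))%:E).
Proof.
apply/(integrable_mkcond _ mD1).
have [+ _] := integrable_fine (integrable_fubini_F intg).
by apply: eq_integrable => // x _; rewrite -FE !patchE; case: ifP.
Qed.

Lemma Fubini1_on : \int[(m1 \x m2)%E]_(z in D1 `*` D2) f z =
  \int[m1]_(x in D1) \int[m2]_(y in D2) f (x, y).
Proof.
have [_ h] := integrable_fine (integrable_fubini_F intg).
rewrite {1}/Rintegral integral_mkcond -integral12_prod_meas1// -h.
rewrite [in RHS]/Rintegral [in RHS]integral_mkcond; congr fine.
by apply: eq_integral => x _; rewrite -FE !patchE; case: ifP.
Qed.

Let intG : m2.-integrable setT (fubini_G m1 g).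
Proof.
have mg := measurable_int _ intg.
apply/integrableP; split; first exact: measurable_fubini_G intg.
have h := (integrable21ltyP m1 m2 mg).1 intg; apply: le_lt_trans h.
apply: ge0_le_integral => //.
- by apply: measurableT_comp => //; exact: measurable_fubini_G intg.
- by apply: (measurable_fun_fubini_tonelli_G (abse \o g)) => //=; exact: measurableT_comp.
- move=> y _; apply: le_abse_integral => //.
  exact: measurableT_comp mg _.
Qed.

Lemma Fubini2_on : \int[(m1 \x m2)%E]_(z in D1 `*` D2) f z =
  \int[m2]_(y in D2) \int[m1]_(x in D1) f (x, y).
Proof.
have [_ h] := integrable_fine intG.
rewrite {1}/Rintegral integral_mkcond -integral21_prod_meas1// -h.
rewrite [in RHS]/Rintegral [in RHS]integral_mkcond; congr fine.
by apply: eq_integral => x _; rewrite -GE !patchE; case: ifP.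
Qed.

End Fubini.
End FubiniOnProducts.

(** * Orthogonality of the Fourier modes *)

Section CosineIntegral.
Context {R : realType}.

Lemma cosD2pin (n : nat) (x : R) : cos (2 * pi * n%:R + x) = cos x.
Proof.
elim: n => [|n IHn]; first by rewrite mulr0 add0r.
rewrite -[RHS]IHn -[RHS]cosD2pi; congr cos.
by rewrite -natr1; ring.
Qed.

Lemma cosD2pi_int (n : int) (x : R) : cos (2 * pi * n%:~R + x) = cos x.
Proof.
case: n => n; first exact: cosD2pin.
by rewrite NegzE mulrNz mulrN -cosN opprD opprK cosD2pin cosN.
Qed.

Lemma sinD2pi_int (n : int) (x : R) : sin (2 * pi * n%:~R + x) = sin x.
Proof. by rewrite -!cosBpihalf -addrA cosD2pi_int. Qed.

Lemma Rintegral_cos_itv (w c a b : R) : a < b -> w != 0 ->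
  \int[lebesgue_measure]_(x in `[a, b]) cos (w * x + c) =
  (sin (w * b + c) - sin (w * a + c)) / w.
Proof.
move=> ab w0; pose F (x : R) := w^-1 * sin (w * x + c).
have dF (x : R) : is_derive x (1 : R) F (cos (w * x + c)).
  apply: is_derive_eq; rewrite addr0 /GRing.scale/=.
  by field.
have cF : continuous F.
  move=> x; apply: differentiable_continuous; apply/derivable1_diffP.
  exact: ex_derive.
have cc : continuous (fun x : R => cos (w * x + c)).
  move=> x; apply: continuous_comp; last exact: continuous_cos.
  by apply: cvgD; [apply: cvgM; [exact: cvg_cst|exact: cvg_id]|exact: cvg_cst].
rewrite /Rintegral (@continuous_FTC2 _ _ F)//.
- by rewrite /F/=; field.
- exact: continuous_subspaceT.
- split.
  + by move=> x _; exact: ex_derive.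
  + exact: cvg_at_right_filter (cF a).
  + exact: cvg_at_left_filter (cF b).
- by move=> x _; rewrite derive1E derive_val.
Qed.

(** The primitive sin (w x + c) / w takes the same value at 0 and at L. *)
Lemma Rintegral_cos_period (L w c : R) (n : int) : 0 < L -> n != 0 ->
  w * L = 2 * pi * n%:~R ->
  \int[lebesgue_measure]_(x in `[0, L]) cos (w * x + c) = 0.
Proof.
move=> L0 n0 wL; have w0 : w != 0.
  apply/eqP => w0; move: wL; rewrite w0 mul0r => /esym/eqP.
  by rewrite !mulf_eq0 intr_eq0 (negbTE n0) pnatr_eq0 orbF/= gt_eqF ?pi_gt0.
by rewrite Rintegral_cos_itv// wL sinD2pi_int mulr0 add0r subrr mul0r.
Qed.

End CosineIntegral.

Section TorusPhases.
Context {R : realType}.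
Local Notation phase := (@phase R).
Local Notation leb2 := (@leb2 R).
Local Notation torus := (@torus R).

Lemma sqrt2_gt0 : 0 < Num.sqrt 2 :> R. Proof. by rewrite sqrtr_gt0. Qed.

Lemma measurable_torus : measurable torus.
Proof. by apply: measurableX; exact: measurable_itv. Qed.

Lemma leb2_torus : leb2 torus = (Num.sqrt 2)%:E.
Proof.
rewrite /leb2 /torus product_measure1E; try exact: measurable_itv.
rewrite /leb1 /= !lebesgue_measure_itv/= !lte_fin ltr01 sqrt2_gt0.
by rewrite !oppr0 !adde0 mule1.
Qed.

Lemma leb2_torus_lty : (leb2 torus < +oo)%E.
Proof. by rewrite leb2_torus ltry. Qed.

Lemma phaseD (k l : int * int) x : phase (k + l) x = phase k x + phase l x.
Proof. by rewrite /phase /freq /= !intrD; field; rewrite gt_eqF ?sqrt2_gt0. Qed.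

Lemma measurable_phase D k : measurable_fun D (phase k).
Proof.
apply: measurable_funTS; apply: measurable_funD; apply: measurable_funM;
  [exact: measurable_cst|exact: measurable_fst|
   exact: measurable_cst|exact: measurable_snd].
Qed.

Lemma measurable_cos_phase D k b : measurable_fun D (fun x => cos (phase k x + b)).
Proof.
have := measurable_trigpoly (@measurable_phase D) (trigpoly_cos phase 1 k b).
by under [in X in X -> _]eq_fun do rewrite mul1r.
Qed.

Lemma cos_norm_le1 (x : R) : `|cos x| <= 1.
Proof. by rewrite ler_norml cos_geN1 cos_le1. Qed.

Lemma sqint_cos_phase k b : sqint leb2 torus (fun x => cos (phase k x + b)).
Proof.
apply: (@sqint_bounded _ _ _ _ _ measurable_torus _ 1).
- exact: leb2_torus_lty.
- exact: measurable_cos_phase.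
- by move=> x _; exact: cos_norm_le1.
Qed.

(** Integrate first in a coordinate in which the frequency does not vanish. *)
Lemma torus_int_cos_phase (k : int * int) b :
  torus_int (fun x => cos (phase k x + b)) =
  if k == 0 then Num.sqrt 2 * cos b else 0.
Proof.
have mI (L : R) : measurable (`[0, L]%classic : set (measurableTypeR R)).
  exact: measurable_itv.
case: eqP => [->|/eqP k0].
  rewrite /torus_int; under eq_Rintegral do rewrite (phase0 phaseD) add0r.
  rewrite Rintegral_cst; last exact: measurable_torus.
  by rewrite (_ : fine _ = Num.sqrt 2) 1?mulrC// -[RHS]/(fine (Num.sqrt 2)%:E) -leb2_torus.
have intc : leb2.-integrable torus (EFin \o (fun x => cos (phase k x + b))).
  apply: measurable_bounded_integrable.
  - exact: measurable_torus.
  - exact: leb2_torus_lty.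
  - exact: measurable_cos_phase.
  - exists 1; split; first by rewrite num_real.
    by move=> M M1 x _ /=; exact: le_trans (cos_norm_le1 _) (ltW M1).
have s0 := sqrt2_gt0.
rewrite /torus_int; have [k2|k2] := eqVneq k.2 0.
  have k1 : k.1 != 0 by apply: contraNN k0 => /eqP k1; case: k k1 k2 {intc} => /= ? ? -> ->.
  have int0 y : \int[@leb1 R]_(x in `[0, Num.sqrt 2]) cos (phase k (x, y) + b) = 0.
    have wL : (freq k).1 * Num.sqrt 2 = 2 * pi * (k.1)%:~R :> R.
      by rewrite /freq/= mulfVK// gt_eqF.
    rewrite -[RHS](Rintegral_cos_period ((freq k).2 * y + b) s0 k1 wL).
    by apply: eq_Rintegral => x _; rewrite /phase/= addrA.
  rewrite (Fubini2_on (mI _) (mI _) intc).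
  under eq_Rintegral => y _ do rewrite int0.
  by rewrite Rintegral_cst ?mul0r.
have int0 x : \int[@leb1 R]_(y in I01) cos (phase k (x, y) + b) = 0.
  have wL : (freq k).2 * 1 = 2 * pi * (k.2)%:~R :> R by rewrite mulr1.
  rewrite -[RHS](Rintegral_cos_period ((freq k).1 * x + b) ltr01 k2 wL).
  by apply: eq_Rintegral => y _; rewrite /phase/= addrA [_ * y + _]addrC.
rewrite (Fubini1_on (mI _) (mI _) intc).
under eq_Rintegral => x _ do rewrite int0.
by rewrite Rintegral_cst ?mul0r.
Qed.

Lemma ip_cos_phase (k l : int * int) a b :
  ip leb2 torus (fun x => cos (phase k x + a)) (fun x => cos (phase l x + b)) =
  Num.sqrt 2 / 2 * ((k == - l)%:R * cos (a + b) + (k == l)%:R * cos (a - b)).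
Proof.
have intc m c : leb2.-integrable torus (EFin \o (fun x => cos (phase m x + c))).
  have := sqint_mul measurable_torus (sqint_cos_phase m c)
    (sqint_cst measurable_torus 1 leb2_torus_lty).
  by apply: eq_integrable; [exact: measurable_torus|move=> x _ /=; rewrite mulr1].
rewrite /ip; under eq_Rintegral => x _.
  rewrite cosMcos.
  rewrite (_ : phase k x + a + _ = phase (k + l) x + (a + b)); last by rewrite phaseD; ring.
  rewrite (_ : phase k x + a - _ = phase (k - l) x + (a - b)); last first.
    by rewrite (phaseB phaseD); ring.
  over.
rewrite RintegralZl; last 2 first.
- exact: measurable_torus.
- apply: eq_integrable (integrableD measurable_torus (intc (k + l) (a + b))
    (intc (k - l) (a - b))) => //; exact: measurable_torus.
rewrite RintegralD; try exact: intc; last exact: measurable_torus.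
rewrite -!/(torus_int _) !torus_int_cos_phase subr_eq0 addr_eq0.
by case: ifP => _; case: ifP => _ /=; field.
Qed.

End TorusPhases.

(** * Fourier series on the torus *)

Section FrequencySets.
Implicit Types (k : int * int) (F : seq (int * int)).

(** The frequencies k and - k carry the same cosine and opposite sines.  With real
    coefficients, the projection onto a set of modes is an orthogonal projection exactly when the
    set contains both. *)
Definition sym_freqs F := uniq F /\ (forall k, k \in F -> - k \in F).

Definition box (N : nat) : seq (int * int) :=
  [seq (i%:Z - N%:Z, j%:Z - N%:Z)
    | i <- iota 0 (N + N).+1, j <- iota 0 (N + N).+1].

Lemma mem_box N k : (k \in box N) = (`|k.1| <= N)%N && (`|k.2| <= N)%N.
Proof.
apply/idP/idP.
  move=> /allpairsP[[i j]] [+ + ->]; rewrite !mem_iota/=.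
  by move=> hi hj; apply/andP; split; lia.
case: k => [i j] /= /andP[hi hj]; apply/allpairsP.
exists (absz (i + N%:Z)%R, absz (j + N%:Z)%R); rewrite !mem_iota/=.
by split; [lia|lia|congr (_, _); lia].
Qed.

Lemma sym_box N : sym_freqs (box N).
Proof.
split=> [|k]; last by rewrite !mem_box; case: k => i j /=; rewrite !abszN.
rewrite /box allpairs_uniq ?iota_uniq// => -[i j] [i' j'] _ _ /=.
by case=> hi hj; congr (_, _); lia.
Qed.

End FrequencySets.

Section FourierProjection.
Context {R : realType}.
Local Notation phase := (@phase R).
Local Notation leb2 := (@leb2 R).
Local Notation torus := (@torus R).
Local Notation ip2 := (ip leb2 torus).
Local Notation L2 := (sqint leb2 torus).
Implicit Types (f g : R * R -> R) (k l : int * int) (F : seq (int * int)).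

Let mT := @measurable_torus R.
Let muT := @leb2_torus_lty R.

Definition cos_coef f k : R := ip2 f (fun x => cos (phase k x)).
Definition sin_coef f k : R := ip2 f (fun x => sin (phase k x)).

(** Each pair {k, - k} with k <> 0 is counted twice, so that the factor (sqrt 2)^-1, the
    inverse of the area of the torus, is the right normalization in Bessel's inequality. *)
Definition fourier_energy F f : R :=
  \sum_(k <- F) (cos_coef f k ^+ 2 + sin_coef f k ^+ 2).

(** The real form of the sum over F of the complex Fourier coefficients times the
    exponentials. *)
Definition fourier_sum F f (x : R * R) : R :=
  (Num.sqrt 2)^-1 * \sum_(k <- F)
    (cos_coef f k * cos (phase k x) + sin_coef f k * sin (phase k x)).

Lemma cos_phaseE k : (fun x => cos (phase k x)) = (fun x => cos (phase k x + 0)).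
Proof. by apply/funext => x; rewrite addr0. Qed.

Lemma sin_phaseE k :
  (fun x => sin (phase k x)) = (fun x => cos (phase k x + - (pi / 2))).
Proof. by apply/funext => x; rewrite cosBpihalf. Qed.

Let Lcos k : L2 (fun x => cos (phase k x)).
Proof. by rewrite cos_phaseE; exact: sqint_cos_phase. Qed.

Let Lsin k : L2 (fun x => sin (phase k x)).
Proof. by rewrite sin_phaseE; exact: sqint_cos_phase. Qed.

Lemma ip_cos_phaseE f l b : L2 f ->
  ip2 f (fun x => cos (phase l x + b)) =
  cos b * cos_coef f l - sin b * sin_coef f l.
Proof.
move=> Lf; rewrite (_ : (fun _ => _) =
    (fun x => cos b * cos (phase l x) - sin b * sin (phase l x))).
  by rewrite (ipBr mT)//; [rewrite !(ipZr mT)|exact: sqintZ|exact: sqintZ].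
by apply/funext => x; rewrite cosD mulrC [sin _ * _]mulrC.
Qed.

Lemma cos_coefN f k : cos_coef f (- k) = cos_coef f k.
Proof.
by apply: eq_ip => // x _; rewrite (phaseN (@phaseD R)) cosN.
Qed.

Lemma sin_coefN f k : L2 f -> sin_coef f (- k) = - sin_coef f k.
Proof.
move=> Lf; rewrite -[RHS]mulN1r -(ipZr mT)//.
by apply: eq_ip => // x _; rewrite (phaseN (@phaseD R)) sinN mulN1r.
Qed.

Lemma sqint_fourier_sum F f : L2 (fourier_sum F f).
Proof.
apply: sqintZ => //; apply: sqint_sum => // k _.
by apply: sqintD => //; exact: sqintZ.
Qed.

Lemma ip_cosr k l b : ip2 (fun x => cos (phase k x)) (fun x => cos (phase l x + b)) =
  Num.sqrt 2 / 2 * ((k == - l)%:R * cos b + (k == l)%:R * cos b).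
Proof. by rewrite cos_phaseE ip_cos_phase add0r sub0r cosN. Qed.

Lemma ip_sinr k l b : ip2 (fun x => sin (phase k x)) (fun x => cos (phase l x + b)) =
  Num.sqrt 2 / 2 * ((k == - l)%:R * sin b - (k == l)%:R * sin b).
Proof.
rewrite sin_phaseE ip_cos_phase [- _ + b]addrC cosBpihalf.
by rewrite -opprD cosN [pi / 2 + b]addrC cosDpihalf mulrN.
Qed.

Lemma sum_pick F (G : int * int -> R) l : uniq F -> l \in F ->
  \sum_(k <- F) (k == l)%:R * G k = G l.
Proof.
move=> uF lF; rewrite (bigD1_seq l)//= eqxx mul1r big1 ?addr0// => k kl.
by rewrite (negbTE kl) mul0r.
Qed.

(** Only the frequencies l and - l of the sum are not orthogonal to this cosine, and
    each contributes half of the value (the whole of it if l = 0). *)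
Lemma ip_fourier_sum F f l b : L2 f -> uniq F -> l \in F -> - l \in F ->
  ip2 (fourier_sum F f) (fun x => cos (phase l x + b)) =
  ip2 f (fun x => cos (phase l x + b)).
Proof.
move=> Lf uF lF NlF; have Le := sqint_cos_phase l b.
have Lt k : L2 (fun x => cos_coef f k * cos (phase k x) + sin_coef f k * sin (phase k x)).
  by apply: sqintD => //; exact: sqintZ.
rewrite (ipZl mT)//; last exact: sqint_sum.
rewrite (ip_suml mT)//.
pose Gp k := cos_coef f k * cos b + sin_coef f k * sin b.
pose Gm k := cos_coef f k * cos b - sin_coef f k * sin b.
rewrite (eq_bigr (fun k => Num.sqrt 2 / 2 * ((k == - l)%:R * Gp k + (k == l)%:R * Gm k))).
  rewrite -mulr_sumr big_split/= !sum_pick// /Gp /Gm cos_coefN sin_coefN//.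
  rewrite ip_cos_phaseE//; field.
  by rewrite gt_eqF ?sqrt2_gt0.
move=> k _; rewrite (ipDl mT) ?(ipZl mT)//; try exact: sqintZ.
by rewrite ip_cosr ip_sinr /Gp /Gm; ring.
Qed.

Lemma ip_fourier_sumr F f g : L2 f -> L2 g ->
  ip2 g (fourier_sum F f) = (Num.sqrt 2)^-1 *
    \sum_(k <- F) (cos_coef f k * cos_coef g k + sin_coef f k * sin_coef g k).
Proof.
move=> Lf Lg; have Lt k : L2 (fun x =>
    cos_coef f k * cos (phase k x) + sin_coef f k * sin (phase k x)).
  by apply: sqintD => //; exact: sqintZ.
rewrite ipC (ipZl mT)//; last exact: sqint_sum.
congr (_ * _); rewrite (ip_suml mT)//; apply: eq_bigr => k _.
rewrite (ipDl mT) ?(ipZl mT)//; try exact: sqintZ.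
by rewrite ![ip2 _ g]ipC.
Qed.

Lemma coef_fourier_sum F f k : L2 f -> sym_freqs F -> k \in F ->
  cos_coef (fourier_sum F f) k = cos_coef f k /\
  sin_coef (fourier_sum F f) k = sin_coef f k.
Proof.
move=> Lf [uF sF] kF; rewrite /cos_coef /sin_coef cos_phaseE sin_phaseE.
by rewrite !ip_fourier_sum ?sF.
Qed.

(** The partial sum s is an orthogonal projection of f: <f,s> = <s,s> is the
    normalized energy of f in the modes of F. *)
Lemma ip_fourier_residual F f : L2 f -> sym_freqs F ->
  ip2 (fun x => f x - fourier_sum F f x) (fun x => f x - fourier_sum F f x) =
  ip2 f f - (Num.sqrt 2)^-1 * fourier_energy F f.
Proof.
move=> Lf sF; have Ls := sqint_fourier_sum F f.
rewrite (ip_subK mT)// !ip_fourier_sumr//.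
rewrite [X in _ + _ * X](eq_big_seq
    (fun k => cos_coef f k * cos_coef f k + sin_coef f k * sin_coef f k)).
  by rewrite /fourier_energy; under eq_bigr do rewrite -!expr2; ring.
by move=> k kF; have [-> ->] := coef_fourier_sum Lf sF kF.
Qed.

Lemma bessel F f : L2 f -> sym_freqs F ->
  (Num.sqrt 2)^-1 * fourier_energy F f <= ip2 f f.
Proof.
by move=> Lf sF; rewrite -subr_ge0 -ip_fourier_residual//; exact: ip_ge0.
Qed.

(** A trigonometric polynomial has frequencies in a box, and the residual is orthogonal
    to all modes of the box. *)
Lemma ip_residual_trigpoly f p : L2 f -> trigpoly phase p ->
  exists N0, forall N, (N0 <= N)%N ->
    ip2 (fun x => f x - fourier_sum (box N) f x) p = 0.
Proof.
move=> Lf; elim=> [a k b|p1 p2 Tp1 [N1 IH1] Tp2 [N2 IH2]].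
  exists (maxn `|k.1| `|k.2|) => N; rewrite geq_max => kN.
  have Ls := sqint_fourier_sum (box N) f.
  have kb : k \in box N by rewrite mem_box.
  have [ub sb] := sym_box N.
  have Le := sqint_cos_phase k b.
  rewrite (ipZr mT)//; last exact: sqintB.
  by rewrite (ipBl mT)// ip_fourier_sum ?sb// subrr mulr0.
exists (maxn N1 N2) => N; rewrite geq_max => /andP[N1N N2N].
have Lp q : trigpoly phase q -> L2 q.
  exact: sqint_trigpoly mT muT (@measurable_phase R _).
rewrite (ipDr mT) ?IH1 ?IH2 ?addr0//; try exact: Lp.
by apply: sqintB => //; exact: sqint_fourier_sum.
Qed.

Lemma negligible_strip1 (a : R) : leb2.-negligible ([set a] `*` setT).
Proof.
exists ([set a] `*` setT); split=> //.
  by apply: measurableX => //; exact: measurable_set1.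
transitivity (@leb1 R [set a] * @leb1 R setT)%E.
  by apply: product_measure1E => //; exact: measurable_set1.
by rewrite [X in (X * _)%E]lebesgue_measure_set1 mul0e.
Qed.

Lemma negligible_strip2 (a : R) : leb2.-negligible (setT `*` [set a]).
Proof.
exists (setT `*` [set a]); split=> //.
  by apply: measurableX => //; exact: measurable_set1.
transitivity (@leb1 R setT * @leb1 R [set a])%E.
  by apply: product_measure1E => //; exact: measurable_set1.
by rewrite [X in (_ * X)%E]lebesgue_measure_set1 mule0.
Qed.

(** The boundary of the fundamental domain has measure zero; its points must be
    avoided because periodic functions cannot separate opposite sides. *)
Lemma ae_torus_interior : {ae leb2, forall x, torus x ->
  0 < x.1 < Num.sqrt 2 /\ 0 < x.2 < 1}.
Proof.
apply: negligibleS (negligibleU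
  (negligibleU (negligible_strip1 0) (negligible_strip1 (Num.sqrt 2)))
  (negligibleU (negligible_strip2 0) (negligible_strip2 1))) => -[x y] /=.
move=> /not_implyP[[/=]]; rewrite !in_itv/= => /andP[x0 xL] /andP[y0 yL] h.
apply: contrapT => /not_orP[/not_orP[hx0 hxL] /not_orP[hy0 hyL]]; apply: h.
rewrite !lt_neqAle x0 xL y0 yL !andbT; split; apply/andP; split; apply/eqP.
- by move=> e; apply: hx0; rewrite -e.
- by move=> e; apply: hxL.
- by move=> e; apply: hy0; rewrite -e.
- by move=> e; apply: hyL.
Qed.

Let ray : set (set R) := [set setT] `|` @RGenInftyO.G R.
Let quadrant : set (set (R * R)) := [set A `*` B | A in ray & B in ray].

Let rayI : setI_closed ray.
Proof.
move=> A B [->|[a ->]] [->|[b ->]]; rewrite ?setTI ?setIT;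
  [by left|by right; exists b|by right; exists a|].
right; exists (Num.min a b).
by rewrite eqEsubset; split => x /=; rewrite !in_itv/= lt_min => /andP.
Qed.

Let ray_measurable A : ray A -> measurable (A : set (measurableTypeR R)).
Proof. by move=> [->//|[a ->]]; exact: measurable_itv. Qed.

(** Products of rays generate the Borel sets of the plane; the whole line is added to
    the rays so that both coordinate projections are measurable. *)
Lemma measurable_quadrant :
  @measurable _ (measurableTypeR R * measurableTypeR R)%type = <<s quadrant >>.
Proof.
rewrite eqEsubset; split.
  have mfst : measurable_fun setT (fst : g_sigma_algebraType quadrant -> measurableTypeR R).
    apply: (measurability _ (@RGenInftyO.measurableE R)) => _ [_ [a ->] <-].
    apply: sub_sigma_algebra; exists `]-oo, a[%classic; first by right; exists a.
    by exists setT; [left|rewrite setTI; apply/seteqP; split => -[x y] []].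
  have msnd : measurable_fun setT (snd : g_sigma_algebraType quadrant -> measurableTypeR R).
    apply: (measurability _ (@RGenInftyO.measurableE R)) => _ [_ [a ->] <-].
    apply: sub_sigma_algebra; exists setT; first by left.
    by exists `]-oo, a[%classic; [right; exists a|rewrite setTI; apply/seteqP; split => -[x y] []].
  apply: smallest_sub; first exact: smallest_sigma_algebra.
  by move=> _ [[X mX <-]|[X mX <-]]; [exact: mfst|exact: msnd].
apply: smallest_sub; first exact: sigma_algebra_measurable.
by move=> _ [A rA [B rB <-]]; apply: measurableX; exact: ray_measurable.
Qed.

(** Indicators of quadrants are products of indicators of rays in each coordinate, to
    which [indic_limit_ray] applies with periods sqrt 2 and 1. *)
Lemma dense_trigpoly2 f : L2 f -> L2_closure leb2 torus (trigpoly phase) f.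
Proof.
have A1 := trigpoly_cst (@phaseD R).
have AD := @trigpolyD R _ _ phase.
have AM := trigpolyM (@phaseD R).
have Ab := @trigpoly_bounded R _ _ phase.
have h1 : forall b, indic_limit leb2 torus (trigpoly phase) (fst @^-1` `]-oo, b[).
  apply: (@indic_limit_ray _ _ _ _ _ _ _ (Num.sqrt 2)) => //.
    move=> b; have := trigpoly_cos phase 1 (1, 0) b.
    congr (trigpoly _ _); apply/funext => x; rewrite mul1r /phase /freq/=; congr (cos (_ + _)).
    by field; rewrite gt_eqF// sqrt2_gt0.
  by apply: filterS ae_torus_interior => x h Tx; have [] := h Tx.
have h2 : forall b, indic_limit leb2 torus (trigpoly phase) (snd @^-1` `]-oo, b[).
  apply: (@indic_limit_ray _ _ _ _ _ _ _ 1) => //.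
    move=> b; have := trigpoly_cos phase 1 (0, 1) b.
    congr (trigpoly _ _); apply/funext => x; rewrite mul1r /phase /freq/=; congr (cos (_ + _)).
    by field; rewrite gt_eqF// sqrt2_gt0.
  by apply: filterS ae_torus_interior => x h Tx; have [] := h Tx.
apply: (@L2_dense _ _ _ _ _ mT muT _ A1 AD AM _ Ab quadrant) => //.
- by move=> g; apply: measurable_trigpoly; exact: measurable_phase.
- exact: measurable_quadrant.
- move=> _ _ [A rA [B rB <-]] [A' rA' [B' rB' <-]].
  exists (A `&` A'); first exact: rayI.
  by exists (B `&` B'); [exact: rayI|rewrite setXI].
- move=> _ [A rA [B rB <-]].
  have -> : A `*` B = (fst @^-1` A) `&` (snd @^-1` B) by [].
  apply: indic_limitI => //.
    by case: rA => [->|[a ->]]; [exact: indic_limitT|exact: h1].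
  by case: rB => [->|[a ->]]; [exact: indic_limitT|exact: h2].
Qed.

(** Since the residual r = f - s is orthogonal to the span of the modes of a large box, a
    trigonometric polynomial p with |f - p|^2 < e gives |r|^2 <= |r|^2 + |s - p|^2 = |f - p|^2 < e. *)
Lemma parseval f (e : R) : L2 f -> 0 < e -> exists N0, forall N, (N0 <= N)%N ->
  ip2 f f - (Num.sqrt 2)^-1 * fourier_energy (box N) f < e.
Proof.
move=> Lf e0; have [_ /(_ _ e0)[p Tp fp]] := dense_trigpoly2 Lf.
have [N0 hN0] := ip_residual_trigpoly Lf Tp; exists N0 => N N0N.
have Ls := sqint_fourier_sum (box N) f.
have Lp : L2 p := sqint_trigpoly mT muT (@measurable_phase R _) Tp.
apply: le_lt_trans fp; rewrite -ip_fourier_residual//; last exact: sym_box.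
have rs : ip2 (fun x => f x - fourier_sum (box N) f x) (fourier_sum (box N) f) = 0.
  rewrite (ipBl mT)// !ip_fourier_sumr//.
  rewrite [X in _ - _ * X](eq_big_seq
    (fun k => cos_coef f k * cos_coef f k + sin_coef f k * sin_coef f k)) ?subrr//.
  by move=> k kN; have [-> ->] := coef_fourier_sum Lf (sym_box N) kN.
have rp := hN0 _ N0N.
have Lr := sqintB mT Lf Ls; have Lq := sqintB mT Ls Lp.
have -> : ip2 (fun x => f x - p x) (fun x => f x - p x) =
    ip2 (fun x => (f x - fourier_sum (box N) f x) + (fourier_sum (box N) f x - p x))
     (fun x => (f x - fourier_sum (box N) f x) + (fourier_sum (box N) f x - p x)).
  by apply: eq_ip => x _; rewrite addrA subrK.
have rq : ip2 (fun x => f x - fourier_sum (box N) f x)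
    (fun x => fourier_sum (box N) f x - p x) = 0.
  by rewrite (ipBr mT Ls Lp Lr) rs rp subrr.
rewrite [leRHS](ip_addK mT Lr Lq) rq mulr0 addr0.
by rewrite lerDl ip_ge0.
Qed.

End FourierProjection.

(** * Sobolev norms and high frequencies *)

Section L2NormTorus.
Context {R : realType}.
Local Notation phase := (@phase R).
Local Notation leb2 := (@leb2 R).
Local Notation torus := (@torus R).
Local Notation ip2 := (ip leb2 torus).
Local Notation L2 := (sqint leb2 torus).
Implicit Types (f g : R * R -> R).

Let mT := @measurable_torus R.

Lemma expe2_poweR (x : \bar R) : (0 <= x)%E -> (x ^+ 2 = x `^ 2)%E.
Proof.
case: x => [r| |]// r0; last by rewrite poweRyr// expeS mulyy.
by rewrite poweR_EFin powR_mulrn.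
Qed.

Lemma L2norm_ge0 f : (0 <= L2norm f)%E.
Proof. exact: Lnorm_ge0. Qed.

Lemma L2norm_sqr f : (L2norm f ^+ 2 = \int[leb2]_(x in torus) (f x ^+ 2)%:E)%E.
Proof.
rewrite expe2_poweR ?L2norm_ge0// /L2norm poweR_Lnorm// [RHS]integral_mkcond.
apply: eq_integral => x _; rewrite !patchE /= patchE.
case: ifPn => _; last by rewrite normr0 powR0.
by rewrite powR_mulrn// real_normK// num_real.
Qed.

Lemma in_L2_sqint f : in_L2 f -> L2 f.
Proof.
move=> [mf foo]; split=> //; apply/integrableP; split.
  by apply/measurable_EFinP; exact: measurable_funX.
under eq_integral do rewrite gee0_abs ?lee_fin ?sqr_ge0//.
rewrite -L2norm_sqr; move: (L2norm_ge0 f) foo.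
by case: (L2norm f) => // r _ _; exact: ltry.
Qed.

Lemma ip_L2norm f : L2 f -> (L2norm f ^+ 2 = (ip2 f f)%:E)%E.
Proof. by move=> Lf; rewrite L2norm_sqr ipE. Qed.

Lemma ip_L2norm_lt f (M : R) : L2 f -> (L2norm f < M%:E)%E -> ip2 f f <= M ^+ 2.
Proof.
move=> Lf; move: (L2norm_ge0 f) (ip_L2norm Lf).
case: (L2norm f) => //= r; rewrite lee_fin lte_fin => r0 -[<-] rM.
by rewrite -expr2 lerXn2r// ?nnegrE// ltW// (le_lt_trans r0).
Qed.

(** Real and imaginary parts of the identity between complex Fourier coefficients. *)
Lemma frac_laplacian_coef s f g k : is_frac_laplacian s f g ->
  cos_coef g k = freq_norm k `^ s * cos_coef f k /\
  sin_coef g k = freq_norm k `^ s * sin_coef f k.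
Proof.
move=> [_ /(_ k)]; rewrite /fourier_coef; set a := freq_norm k `^ s.
have cE h : torus_int (fun x => h x * cos (phase k x)) = cos_coef h k by [].
have sE h : torus_int (fun x => h x * sin (phase k x)) = sin_coef h k by [].
rewrite !cE !sE.
have s0 : (Num.sqrt 2)^-1 != 0 :> R by rewrite invr_eq0 gt_eqF// sqrt2_gt0.
move=> h; split; apply: (mulfI s0).
  by have := congr1 (@complex.Re R) h; rewrite /= !mul0r subr0 => ->; ring.
have := congr1 (@complex.Im R) h; rewrite /= !mul0r addr0 mulrN => /oppr_inj ->.
by ring.
Qed.

Lemma freq_norm_ge0 k : 0 <= freq_norm k :> R.
Proof. exact: sqrtr_ge0. Qed.

(** Bessel's inequality for g = (-Delta)^(s/2) f, whose coefficients in F are those of f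
    multiplied by at least rho^s. *)
Lemma sobolev_tail s f (M rho : R) (F : seq (int * int)) :
  0 < s -> L2 f -> (Hsnorm s f < M%:E)%E -> sym_freqs F -> 0 < rho ->
  (forall k, k \in F -> rho <= freq_norm k) ->
  fourier_energy F f <= Num.sqrt 2 * M ^+ 2 / (rho `^ s) ^+ 2.
Proof.
move=> s0 Lf /ereal_inf_lt[_ [g lap <-] gM] sF rho0 Frho.
have Lg : L2 g by apply: in_L2_sqint; case: lap.
have r0 : 0 < (rho `^ s) ^+ 2 by rewrite exprn_gt0// powR_gt0.
rewrite ler_pdivlMr//; apply: le_trans (_ : fourier_energy F g <= _).
  rewrite /fourier_energy mulr_suml big_seq [leRHS]big_seq; apply: ler_sum => k kF.
  have [-> ->] := frac_laplacian_coef k lap.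
  rewrite !exprMn -mulrDr mulrC ler_wpM2r ?addr_ge0 ?sqr_ge0//.
  rewrite lerXn2r ?nnegrE ?powR_ge0// ge0_ler_powR ?nnegrE ?freq_norm_ge0// ?Frho// ltW//.
have := le_trans (bessel Lg sF) (ip_L2norm_lt Lg gM).
by rewrite mulrC ler_pdivrMr ?sqrt2_gt0// mulrC.
Qed.

Lemma freq_norm_box (N : nat) k : k \notin box N -> N%:R <= freq_norm k :> R.
Proof.
have h (x y : R) : `|x| <= Num.sqrt (x ^+ 2 + y ^+ 2).
  by rewrite -sqrtr_sqr ler_sqrt ?addr_ge0 ?sqr_ge0// lerDl sqr_ge0.
have pi2 : 2 <= pi :> R by exact: pi_ge2.
have s2 : Num.sqrt 2 <= 2 :> R.
  have := sqr_sqrtr (ler0n R 2); have := sqrtr_ge0 (2 : R).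
  by rewrite leNgt => h0 h2; apply/negP => h3; nra.
have s0 := @sqrt2_gt0 R.
have intN (i : int) : (N < `|i|)%N -> N%:R <= `|i%:~R| :> R.
  by move=> /ltnW Ni; rewrite -intr_norm -abszE -[leLHS]/(N%:~R) ler_int lez_nat.
have lek (c : R) (i : int) : 1 <= c -> N%:R <= `|i%:~R| :> R -> N%:R <= `|c * i%:~R| :> R.
  move=> c1 hi; rewrite normrM ger0_norm; last by rewrite (le_trans _ c1).
  by apply: (le_trans hi); rewrite ler_peMl.
rewrite mem_box => /nandP[]; rewrite -ltnNge => /intN hk.
  apply: le_trans (h (freq k).1 (freq k).2); rewrite /freq/= mulrAC.
  by apply: lek => //; rewrite ler_pdivlMr// mul1r; lra.
rewrite /freq_norm addrC; apply: le_trans (h (freq k).2 (freq k).1).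
by rewrite /freq/=; apply: lek => //; lra.
Qed.

End L2NormTorus.

(** * Functions of time and space *)

Section SpaceTime.
Context {R : realType}.
Local Notation leb1 := (@leb1 R).
Local Notation leb2 := (@leb2 R).
Local Notation leb3 := (@leb3 R).
Local Notation torus := (@torus R).
Local Notation spacetime := (@spacetime R).
Local Notation ip1 := (ip leb1 I01).
Local Notation ip2 := (ip leb2 torus).
Local Notation ip3 := (ip leb3 spacetime).
Local Notation L2t := (sqint leb1 I01).
Local Notation L2x := (sqint leb2 torus).
Local Notation L2tx := (sqint leb3 spacetime).
Implicit Types (f g : R * (R * R) -> R).

Let mI : measurable (I01 : set (measurableTypeR R)).
Proof. exact: measurable_itv. Qed.

Let mT := @measurable_torus R.

Let mu1 : (leb1 I01 < +oo)%E. Proof. by rewrite leb1_itv01 ltry. Qed.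

Lemma measurable_spacetime : measurable spacetime.
Proof. exact: measurableX. Qed.

Lemma leb3_spacetime_lty : (leb3 spacetime < +oo)%E.
Proof.
rewrite /leb3 /spacetime product_measure1E; [|exact: mI|exact: mT].
by rewrite [X in (X * _)%E]leb1_itv01 mul1e; exact: leb2_torus_lty.
Qed.

Let tonelli3 (F : R * (R * R) -> \bar R) : measurable_fun spacetime F ->
  (forall z, spacetime z -> (0 <= F z)%E) ->
  (\int[leb3]_(z in spacetime) F z =
   \int[leb1]_(t in I01) \int[leb2]_(x in torus) F (t, x))%E.
Proof. by move=> mF F0; exact: (@tonelli_on _ _ _ _ R leb1 leb2 I01 torus mI mT F mF F0). Qed.

Lemma measurable_slice_on f t : measurable_fun spacetime f -> I01 t ->
  measurable_fun torus (slice f t).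
Proof. by move=> mf It; exact: (measurable_slice1 mI mT mf It). Qed.

Lemma measurable_L2norm_slice f : measurable_fun spacetime f ->
  measurable_fun (I01 : set R) (fun t => L2norm (slice f t)).
Proof.
move=> mf; rewrite (_ : (fun _ => _) = (fun t =>
    (\int[leb2]_(x in torus) (f (t, x) ^+ 2)%:E) `^ 2^-1)%E).
  apply: (measurableT_comp (measurable_poweR _)).
  have := @measurable_integral_slice _ _ _ _ R leb2
    (I01 : set (measurableTypeR R)) torus mI mT
    (fun z => (f z ^+ 2)%:E); apply.
    by apply/measurable_EFinP; exact: measurable_funX.
  by move=> z _; rewrite lee_fin sqr_ge0.
apply/funext => t; rewrite -[X in (X `^ _)%E](L2norm_sqr (slice f t)).
by rewrite expe2_poweR ?L2norm_ge0// -poweRrM mulfV// poweRe1// L2norm_ge0.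
Qed.

Lemma sqint_slices f : measurable_fun spacetime f ->
  (\int[leb1]_(t in I01) (L2norm (slice f t) ^+ 2) < +oo)%E -> L2tx f.
Proof.
move=> mf foo; split=> //; apply/integrableP; split.
  by apply/measurable_EFinP; exact: measurable_funX.
under eq_integral do rewrite gee0_abs ?lee_fin ?sqr_ge0//.
rewrite tonelli3.
- by under eq_integral => t _ do rewrite -(L2norm_sqr (slice f t)).
- by apply/measurable_EFinP; exact: measurable_funX.
- by move=> z _; rewrite lee_fin sqr_ge0.
Qed.

Lemma Linf_L2_bound f : in_Linf_L2 f -> exists2 C : R, 0 < C &
  {ae leb1, forall t, I01 t -> (L2norm (slice f t) < C%:E)%E}.
Proof.
move=> [mf]; rewrite /Linf_time => foo.
have h := @ess_sup_ge _ _ _ leb1 ((fun t => L2norm (slice f t)) \_ I01).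
have [C CE] : exists C : R, (ess_sup leb1 ((fun t => L2norm (slice f t)) \_ I01) <= C%:E)%E.
  by move: foo; case: (ess_sup _ _) => [r _|//|_]; [exists r|exists 0; rewrite leNye].
exists (`|C| + 1); first by rewrite ltr_wpDl.
apply: ae_imp h => t /= h It; rewrite patchE mem_set// in h.
apply: (le_lt_trans (le_trans h CE)); rewrite lte_fin.
by rewrite (le_lt_trans (ler_norm C))// ltrDl.
Qed.

(** Time has finite measure, so that L^oo([0,1], L^2) embeds in L^2 of space-time. *)
Lemma Linf_L2_sqint f : in_Linf_L2 f -> L2tx f.
Proof.
move=> Lf; have [C C0 hC] := Linf_L2_bound Lf; apply: sqint_slices; first exact: Lf.1.
have hC2 : {ae leb1, forall t, I01 t -> (L2norm (slice f t) ^+ 2 <= (C ^+ 2)%:E)%E}.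
  apply: ae_imp hC => t /= h It; have {}h := h It.
  move: (L2norm_ge0 (slice f t)) h; case: (L2norm _) => //= r.
  rewrite !lee_fin lte_fin => r0 rC.
  by rewrite -expr2 lerXn2r ?nnegrE ?(ltW C0) ?(ltW rC).
apply: (@le_lt_trans _ _ (\int[leb1]_(t in I01) (C ^+ 2)%:E)%E); last first.
  by rewrite integral_cst// [X in (_ * X)%E]leb1_itv01 mule1 ltry.
apply: ae_ge0_le_integral => //.
- by move=> t _; rewrite expe_ge0// L2norm_ge0.
- rewrite (_ : (fun _ => _) = (fun t => L2norm (slice f t) * L2norm (slice f t))%E).
    by apply: emeasurable_funM; apply: measurable_L2norm_slice; exact: Lf.1.
  by apply/funext => t; rewrite expeS.
- by move=> t _; rewrite lee_fin sqr_ge0.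
Qed.

Lemma ae_sqint_slice f : L2tx f ->
  {ae leb1, forall t, I01 t -> L2x (slice f t)}.
Proof.
move=> [mf intf].
apply: ae_imp (ae_integrable_slice mI mT intf) => t /= h It.
by split; [exact: measurable_slice_on|exact: h].
Qed.

Lemma integrable_ip_slices f g : L2tx f -> L2tx g ->
  leb1.-integrable I01 (fun t => (ip2 (slice f t) (slice g t))%:E).
Proof.
move=> Lf Lg; have := sqint_mul measurable_spacetime Lf Lg.
exact: (integrable_Rintegral_slice mI mT (f := fun z => f z * g z)).
Qed.

Lemma ip3_slices f g : L2tx f -> L2tx g ->
  ip3 f g = \int[leb1]_(t in I01) ip2 (slice f t) (slice g t).
Proof.
move=> Lf Lg; have := sqint_mul measurable_spacetime Lf Lg.
exact: (Fubini1_on mI mT (f := fun z => f z * g z)).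
Qed.

(** At each time the norm satisfies |f(t)| <= 1 + |f(t)|^2.  Weak-* convergence therefore applies to
    square-integrable test functions, for which the pairing is [ip]. *)
Lemma sqint_in_L1_L2 f : L2tx f -> in_L1_L2 f.
Proof.
move=> Lf; split; first exact: Lf.1.
have intf := integrable_ip_slices Lf Lf.
have [_ int1] := sqint_cst mI 1 mu1.
have intD := integrableD mI int1 intf.
have le1 : {ae leb1, forall t, I01 t -> (L2norm (slice f t) <=
    (cst 1 t ^+ 2)%:E + (ip2 (slice f t) (slice f t))%:E)%E}.
  apply: ae_imp (ae_sqint_slice Lf) => t /= h It; have {}h := h It.
  have := ip_L2norm h; move: (L2norm_ge0 (slice f t)); case: (L2norm _) => //= r.
  by rewrite lee_fin => r0 -[<-]; rewrite -EFinD lee_fin; nra.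
apply: (le_lt_trans _ (integrable_lty mI intD)); apply: ae_ge0_le_integral => //.
- by move=> t _; exact: L2norm_ge0.
- by apply: measurable_L2norm_slice; exact: Lf.1.
- by move=> t _; rewrite adde_ge0// lee_fin ?sqr_ge0// ip_ge0.
- exact: measurable_int intD.
Qed.

Lemma sqint_tensor (g : R -> R) (e : R * R -> R) (C : R) : L2t g ->
  measurable_fun torus e -> (forall x, torus x -> `|e x| <= C) ->
  L2tx (fun z => g z.1 * e z.2).
Proof.
move=> Lg me eC.
have mge : measurable_fun spacetime (fun z : R * (R * R) => g z.1 * e z.2).
  apply: measurable_funM.
    apply: (measurable_comp (F := (I01 : set (measurableTypeR R))) (f := g)) => //; [|exact: Lg.1|].
      by move=> _ [[t x] [/= It _] <-].
    by apply: measurable_funTS; exact: measurable_fst.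
  apply: (measurable_comp (F := torus) (f := e)) => //.
    by move=> _ [[t x] [/= _ Tx] <-].
  by apply: measurable_funTS; exact: measurable_snd.
split=> //; apply/integrableP; split.
  by apply/measurable_EFinP; exact: measurable_funX.
under eq_integral do rewrite gee0_abs ?lee_fin ?sqr_ge0//.
rewrite tonelli3; last 2 first.
- by apply/measurable_EFinP; exact: measurable_funX.
- by move=> z _; rewrite lee_fin sqr_ge0.
have Le := sqint_bounded mT leb2_torus_lty me eC.
have [_ intg] := Lg; have := integrable_lty mI (integrableZl mI (ip2 e e) intg).
congr (_ < _)%E; apply: eq_integral => t _ /=.
under [RHS]eq_integral do rewrite exprMn EFinM.
by rewrite integralZl//; [rewrite (ipE mT Le) muleC|exact: Le.2].
Qed.

Lemma ip3_time_factor (f g : R * (R * R) -> R) (h : R -> R) (C : R) : L2tx f -> L2tx g ->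
  measurable_fun (setT : set R) h -> (forall t, `|h t| <= C) ->
  ip3 f (fun z => h z.1 * g z) =
  \int[leb1]_(t in I01) (h t * ip2 (slice f t) (slice g t)).
Proof.
move=> Lf Lg mh hC.
have Lhg : L2tx (fun z => h z.1 * g z).
  rewrite (_ : (fun _ => _) = (fun z => g z * h z.1)); last first.
    by apply/funext => z; rewrite mulrC.
  apply: (sqint_bmul measurable_spacetime Lg (C := C)) => [|z _]; last exact: hC.
  by apply: measurable_funTS; apply: (measurableT_comp mh); exact: measurable_fst.
rewrite ip3_slices//.
have ifg := integrable_ip_slices Lf Lg.
congr fine; apply: ae_eq_integral => //.
- by have /measurable_int := integrable_ip_slices Lf Lhg.
- apply/measurable_EFinP; apply: measurable_funM; first exact: measurable_funTS.
  by have /measurable_int/measurable_EFinP := ifg.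
- apply: ae_imp2 (ae_sqint_slice Lf) (ae_sqint_slice Lg) => t /= hf hg It.
  by rewrite -(ipZr mT (h t) (hg It) (hf It)).
Qed.

Section Coefficient.
Variables (f : R * (R * R) -> R) (e : R * R -> R) (C : R).
Hypotheses (Lf : L2tx f) (me : measurable_fun torus e).
Hypothesis eC : forall x, torus x -> `|e x| <= C.

Let Le : L2x e. Proof. exact: sqint_bounded leb2_torus_lty me eC. Qed.

(** By the Cauchy-Schwarz inequality at each time, the square of the coefficient is
    at most <f(t), f(t)> <e, e>, which is integrable in time. *)
Lemma sqint_coefficient : L2t (fun t => ip2 (slice f t) e).
Proof.
have L1 := sqint_tensor (sqint_cst mI 1 mu1) me eC.
have intfe := integrable_ip_slices Lf L1.
have me' : measurable_fun (I01 : set R) (fun t => ip2 (slice f t) e).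
  have /measurable_EFinP := measurable_int _ intfe; apply: eq_measurable_fun => t _.
  by apply: eq_ip => // x _; rewrite /slice/= mul1r.
split=> //; apply/integrableP; split.
  by apply/measurable_EFinP; exact: measurable_funX.
have intff := integrableZr mI (ip2 e e) (integrable_ip_slices Lf Lf).
have le1 : {ae leb1, forall t, I01 t -> (`|((ip2 (slice f t) e) ^+ 2)%:E| <=
    (ip2 (slice f t) (slice f t))%:E * (ip2 e e)%:E)%E}.
  apply: ae_imp (ae_sqint_slice Lf) => t /= h It.
  rewrite -EFinM lee_fin ger0_norm ?sqr_ge0//.
  by apply: ip_cauchy_schwarz => //; exact: h.
apply: (le_lt_trans _ (integrable_lty mI intff)); apply: ae_ge0_le_integral => //.
- by apply: measurableT_comp => //; apply/measurable_EFinP; exact: measurable_funX.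
- by move=> t _; rewrite mule_ge0 ?lee_fin ?ip_ge0.
- exact: measurable_int intff.
Qed.

Lemma ip3_tensor (g : R -> R) : L2t g ->
  ip3 f (fun z => g z.1 * e z.2) = ip1 (fun t => ip2 (slice f t) e) g.
Proof.
move=> Lg; rewrite ip3_slices//; last exact: sqint_tensor eC.
have ae_f : ae_eq leb1 I01
    (fun t => (ip2 (slice f t) (slice (fun z => g z.1 * e z.2) t))%:E)
    (fun t => (ip2 (slice f t) e * g t)%:E).
  apply: ae_imp (ae_sqint_slice Lf) => t /= h It; congr (_%:E).
  by rewrite mulrC -(ipZr mT (g t) Le (h It)).
congr fine; apply: ae_eq_integral ae_f => //.
- by have /measurable_int := integrable_ip_slices Lf (sqint_tensor Lg me eC).
- by have /measurable_int := sqint_mul mI sqint_coefficient Lg.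
Qed.

End Coefficient.

End SpaceTime.

(** * Trigonometric test functions *)

Section SmoothTests.
Context {R : realType}.
Implicit Types (l z v : R * (R * R)) (f : R * (R * R) -> R).

(** Linear phases on the whole of space-time, with arbitrary real frequencies: smoothness
    of trigonometric polynomials does not depend on periodicity. *)
Definition lin3 l z : R := l.1 * z.1 + (l.2.1 * z.2.1 + l.2.2 * z.2.2).

Lemma lin3D l l' z : lin3 (l + l') z = lin3 l z + lin3 l' z.
Proof. by rewrite /lin3/=; ring. Qed.

Lemma lin3_line l z v (h : R) : lin3 l (h *: v + z) = lin3 l v * h + lin3 l z.
Proof. by rewrite /lin3/= /GRing.scale/=; ring. Qed.

Lemma is_derive_line f z v (d : R) :
  is_derive (0 : R) (1 : R) (fun h : R => f (h *: v + z)) d -> is_derive z v f d.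
Proof.
move=> [dg gd].
have E : (fun h : R => h^-1 *: ((f \o shift z) (h *: v) - f z)) =
    (fun h : R => h^-1 *: (((fun h : R => f (h *: v + z)) \o shift 0) (h *: (1 : R)) -
       (fun h : R => f (h *: v + z)) 0)).
  apply/funext => h; rewrite /= scale0r add0r addr0.
  by rewrite /GRing.scale/= mulr1.
split; first by rewrite /derivable E.
by rewrite /derive E.
Qed.

Lemma is_derive_cos_lin3 (a : R) l (b : R) z v :
  is_derive z v (fun z => a * cos (lin3 l z + b))
    (- (a * lin3 l v * sin (lin3 l z + b))).
Proof.
apply: is_derive_line.
rewrite (_ : (fun _ => _) = (fun h : R => a * cos (lin3 l v * h + (lin3 l z + b)))).
  apply: is_derive_eq; rewrite mulr0 add0r /GRing.scale/= addr0.
  by ring.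
by apply/funext => h; rewrite lin3_line -addrA.
Qed.

Lemma continuous_lin3 l : continuous (lin3 l).
Proof.
move=> z; apply: cvgD; first by apply: cvgM; [exact: cvg_cst|exact: cvg_fst].
apply: cvgD; apply: cvgM; try exact: cvg_cst.
  by apply: (@cvg_comp _ _ _ snd fst); [exact: cvg_snd|exact: cvg_fst].
by apply: (@cvg_comp _ _ _ snd snd); [exact: cvg_snd|exact: cvg_snd].
Qed.

Lemma continuous_trig3 f : trigpoly lin3 f -> continuous f.
Proof.
elim=> [a l b|f1 f2 _ c1 _ c2] z; last by apply: cvgD; [exact: c1|exact: c2].
apply: cvgM; first exact: cvg_cst.
apply: (continuous_comp (f := fun z => lin3 l z + b)); last exact: continuous_cos.
by apply: cvgD; [exact: continuous_lin3|exact: cvg_cst].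
Qed.

Lemma derivable_trig3 f z v : trigpoly lin3 f -> derivable f z v.
Proof.
elim=> [a l b|f1 f2 _ c1 _ c2]; last exact: derivableD.
by have [] := is_derive_cos_lin3 a l b z v.
Qed.

Lemma derive_trig3 f v : trigpoly lin3 f -> trigpoly lin3 ('D_v f).
Proof.
elim=> [a l b|f1 f2 T1 c1 T2 c2].
  rewrite (_ : 'D_v _ = (fun z => (- (a * lin3 l v)) * cos (lin3 l z + (b - pi / 2)))).
    exact: trigpoly_cos.
  apply/funext => z; have [_ ->] := is_derive_cos_lin3 a l b z v.
  by rewrite addrA cosBpihalf mulNr.
rewrite (_ : 'D_v _ = (fun z => 'D_v f1 z + 'D_v f2 z)); first exact: trigpolyD.
by apply/funext => z; rewrite -deriveD//; exact: derivable_trig3.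
Qed.

(** Directional derivatives of trigonometric polynomials are again trigonometric
    polynomials, hence so are all the iterated ones. *)
Lemma smooth_trig3 f : trigpoly lin3 f -> smooth f.
Proof.
move=> Tf vs; set g := foldr _ _ _.
have Tg : trigpoly lin3 g.
  by rewrite /g {g}; elim: vs => //= v vs IH; exact: derive_trig3.
by split; [exact: continuous_trig3|move=> z v; exact: derivable_trig3].
Qed.

End SmoothTests.

Section TestFunctions.
Context {R : realType}.
Variables (n : int) (beta : R) (k : int * int) (c : R).
Implicit Types (z : R * (R * R)).
Local Notation phase := (@phase R).

(** A periodic function of time vanishing at both ends of [0,1]; the constant is subtracted
    for that purpose.  These span all trigonometric polynomials that vanish at 0. *)
Definition bump (t : R) : R := cos (phase1 n t + beta) - cos beta.

Definition test z : R := bump z.1 * cos (phase k z.2 + c).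

Lemma bump0 : bump 0 = 0.
Proof. by rewrite /bump /phase1 mulr0 add0r subrr. Qed.

Lemma bump1 : bump 1 = 0.
Proof. by rewrite /bump /phase1 mulr1 cosD2pi_int subrr. Qed.

Lemma trig3_test : trigpoly lin3 test.
Proof.
have T1 : trigpoly lin3 (fun z => cos (phase1 n z.1 + beta)).
  have := trigpoly_cos lin3 1 (2 * pi * n%:~R, (0, 0)) beta.
  congr trigpoly; apply/funext => z; rewrite mul1r /lin3 /phase1/=.
  by congr (cos (_ + _)); ring.
have T2 : trigpoly lin3 (fun z => cos (phase k z.2 + c)).
  have := trigpoly_cos lin3 1 (0, ((freq k).1, (freq k).2)) c.
  congr trigpoly; apply/funext => z; rewrite mul1r /lin3 /phase/=.
  by congr (cos (_ + _)); ring.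
apply: (trigpolyM lin3D) => //.
exact: trigpolyD T1 (trigpoly_cst lin3D _).
Qed.

Lemma periodic_test : torus_periodic test.
Proof.
move=> t x y; rewrite /test /phase/=; split; congr (_ * _).
  rewrite -[RHS](cosD2pi_int k.1); congr cos; rewrite /freq/=; field.
  by rewrite gt_eqF// sqrt2_gt0.
by rewrite -[RHS](cosD2pi_int k.2); congr cos; rewrite /freq/=; ring.
Qed.

Definition dbump (t : R) : R := - (2 * pi * n%:~R * sin (phase1 n t + beta)).

Lemma is_derive_bump (t : R) : is_derive t (1 : R) bump (dbump t).
Proof.
rewrite /bump /phase1; apply: is_derive_eq.
by rewrite /dbump /phase1 /GRing.scale/= !addr0 subr0; ring.
Qed.

Lemma dt_test z : dt test z = dbump z.1 * cos (phase k z.2 + c).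
Proof.
suff [_ h] : is_derive z ((1, (0, 0)) : R * (R * R)) test
  (dbump z.1 * cos (phase k z.2 + c)) by exact: h.
apply: is_derive_line.
rewrite (_ : (fun _ => _) = (fun h : R =>
    (cos (2 * pi * n%:~R * h + (phase1 n z.1 + beta)) - cos beta) *
    cos (phase k z.2 + c))).
  apply: is_derive_eq; rewrite mulr0 add0r /GRing.scale/= /dbump /phase1.
  by ring.
apply/funext => h.
transitivity (test (h * 1 + z.1, (h * 0 + z.2.1, h * 0 + z.2.2))); first by [].
rewrite /test /bump /phase1 /phase/= !mulr0 !add0r mulr1.
by congr ((cos _ - _) * _); ring.
Qed.

Lemma dx_test z : dx test z = bump z.1 * - ((freq k).1 * sin (phase k z.2 + c)).
Proof.
suff [_ h] : is_derive z ((0, (1, 0)) : R * (R * R)) test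
  (bump z.1 * - ((freq k).1 * sin (phase k z.2 + c))) by exact: h.
apply: is_derive_line.
rewrite (_ : (fun _ => _) = (fun h : R => bump z.1 * cos ((freq k).1 * h + (phase k z.2 + c)))).
  apply: is_derive_eq; rewrite mulr0 add0r /GRing.scale/=.
  by ring.
apply/funext => h.
transitivity (test (h * 0 + z.1, (h * 1 + z.2.1, h * 0 + z.2.2))); first by [].
rewrite /test /= !mulr0 !add0r.
by congr (_ * cos _); rewrite /phase/=; ring.
Qed.

Lemma dy_test z : dy test z = bump z.1 * - ((freq k).2 * sin (phase k z.2 + c)).
Proof.
suff [_ h] : is_derive z ((0, (0, 1)) : R * (R * R)) test
  (bump z.1 * - ((freq k).2 * sin (phase k z.2 + c))) by exact: h.
apply: is_derive_line.
rewrite (_ : (fun _ => _) = (fun h : R => bump z.1 * cos ((freq k).2 * h + (phase k z.2 + c)))).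
  apply: is_derive_eq; rewrite mulr0 add0r /GRing.scale/=.
  by ring.
apply/funext => h.
transitivity (test (h * 0 + z.1, (h * 0 + z.2.1, h * 1 + z.2.2))); first by [].
rewrite /test /= !mulr0 !add0r.
by congr (_ * cos _); rewrite /phase/=; ring.
Qed.

End TestFunctions.

(** * The equation satisfied by the weak limit *)

Section LimitEquation.
Context {R : realType}.
Local Notation leb3 := (@leb3 R).
Local Notation spacetime := (@spacetime R).
Local Notation ip3 := (ip leb3 spacetime).
Local Notation L2tx := (sqint leb3 spacetime).
Implicit Types (f g : R * (R * R) -> R) (u : R * (R * R) -> R * R).

Let mST := @measurable_spacetime R.
Let muST := @leb3_spacetime_lty R.

Lemma measurable_lin3 D (l : R * (R * R)) : measurable_fun D (lin3 l).
Proof.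
apply: measurable_funTS; apply: measurable_funD.
  by apply: measurable_funM; [exact: measurable_cst|exact: measurable_fst].
apply: measurable_funD; apply: measurable_funM; try exact: measurable_cst.
  by apply: (measurableT_comp measurable_fst); exact: measurable_snd.
by apply: (measurableT_comp measurable_snd); exact: measurable_snd.
Qed.

Lemma sqint_trig3 f : trigpoly lin3 f -> L2tx f.
Proof. by move=> Tf; apply: (sqint_trigpoly mST muST _ Tf) => l; exact: measurable_lin3. Qed.

(** The norm of the plane R * R is the maximum norm, which dominates both components. *)
Lemma sqint_velocity u : in_Linf u ->
  L2tx (fun z => (u z).1) /\ L2tx (fun z => (u z).2).
Proof.
move=> [mu]; set F := (F in ess_sup _ F) => foo.
have h := @ess_sup_ge _ _ _ leb3 F.
have [C CE] : exists C : R, (ess_sup leb3 F <= C%:E)%E.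
  by move: foo; case: (ess_sup _ _) => [r _|//|_]; [exists r|exists 0; rewrite leNye].
have uC : {ae leb3, forall z, spacetime z -> `|u z| <= C}.
  apply: ae_imp h => z /= h Sz; rewrite /F patchE mem_set// in h.
  by rewrite -lee_fin; exact: le_trans CE.
have n1 (p : R * R) : `|p.1| <= `|p| by rewrite [leRHS]prod_normE le_max lexx.
have n2 (p : R * R) : `|p.2| <= `|p| by rewrite [leRHS]prod_normE le_max lexx orbT.
split; apply: (@sqint_ae_bounded _ _ _ _ _ _ C mST muST).
- exact: measurableT_comp measurable_fst mu.
- by apply: ae_imp uC => z hz Sz; exact: le_trans (n1 _) (hz Sz).
- exact: measurableT_comp measurable_snd mu.
- by apply: ae_imp uC => z hz Sz; exact: le_trans (n2 _) (hz Sz).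
Qed.

Lemma sqint_advect u f : in_Linf u -> trigpoly lin3 f -> L2tx (advect u f).
Proof.
move=> /sqint_velocity[L1 L2] Tf.
have Tx := derive_trig3 (0, (1, 0)) Tf; have Ty := derive_trig3 (0, (0, 1)) Tf.
have [Cx hx] := trigpoly_bounded Tx; have [Cy hy] := trigpoly_bounded Ty.
apply: sqintD => //.
  exact: (sqint_bmul mST L1 (sqint_trig3 Tx).1 (fun z _ => hx z)).
exact: (sqint_bmul mST L2 (sqint_trig3 Ty).1 (fun z _ => hy z)).
Qed.

(** The weak formulation for theta^(kappa_j) has three terms; against a fixed trigonometric
    polynomial each pairing converges, and the diffusive one is multiplied by kappa_j, which tends
    to 0.  The initial term vanishes together with f at time 0. *)
Lemma limit_equation u theta0 (thetak : nat -> R * (R * R) -> R) theta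
    (kappa : nat -> R) f :
  in_Linf u -> (forall j, weak_solution (kappa j) u theta0 (thetak j)) ->
  kappa j @[j --> \oo] --> 0 -> weakstar_cvg thetak theta ->
  in_Linf_L2 theta ->
  trigpoly lin3 f -> torus_periodic f ->
  (forall x, f (0, x) = 0) -> (forall x, f (1, x) = 0) ->
  ip3 theta (dt f) + ip3 theta (advect u f) = 0.
Proof.
move=> Lu sol k0 wcv Lth Tf perf f0 f1.
have Lt : L2tx (dt f) by apply/sqint_trig3/derive_trig3.
have Lxy : L2tx (laplacian f).
  apply/sqint_trig3/trigpolyD; apply: (derive_trig3 (0, _)); exact: derive_trig3.
have La := sqint_advect Lu Tf.
have wc g : L2tx g -> ip3 (thetak j) g @[j --> \oo] --> ip3 theta g.
  by move=> Lg; exact: wcv (sqint_in_L1_L2 Lg).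
have eq0 j : ip3 (thetak j) (dt f) + kappa j * ip3 (thetak j) (laplacian f) +
    ip3 (thetak j) (advect u f) = 0.
  have [Lj _ /(_ f (smooth_trig3 Tf) perf f1)] := sol j.
  rewrite [X in _ + X](_ : _ = 0) ?addr0 => [<-|]; last first.
    rewrite /torus_int; under eq_Rintegral do rewrite f0 mulr0.
    by rewrite Rintegral_cst ?mul0r//; exact: measurable_torus.
  have Ljt := Linf_L2_sqint Lj.
  have Lkl := sqintZ mST (kappa j) Lxy.
  transitivity (ip3 (thetak j) (fun z => dt f z + kappa j * laplacian f z + advect u f z)).
    by rewrite (ipDr mST (sqintD mST Lt Lkl) La Ljt) (ipDr mST)// (ipZr mST).
  by [].
have : ip3 (thetak j) (dt f) + kappa j * ip3 (thetak j) (laplacian f) +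
    ip3 (thetak j) (advect u f) @[j --> \oo] -->
    ip3 theta (dt f) + 0 * ip3 theta (laplacian f) + ip3 theta (advect u f).
  apply: cvgD; last exact: wc.
  by apply: cvgD; [exact: wc|apply: cvgM; [exact: k0|exact: wc]].
under eq_fun do rewrite eq0.
rewrite mul0r addr0 => h; apply: (cvg_unique _ h).
  by [].
exact: cvg_cst.
Qed.

End LimitEquation.

(** * Functions of time with an integrable weak derivative *)

Section DuBoisReymond.
Context {R : realType}.
Local Notation leb1 := (@leb1 R).
Local Notation ip1 := (ip leb1 I01).
Local Notation L2t := (sqint leb1 I01).
Implicit Types (a b h : R -> R).

Let mI : measurable (I01 : set (measurableTypeR R)).
Proof. exact: measurable_itv. Qed.

Let mu1 : (leb1 I01 < +oo)%E. Proof. by rewrite leb1_itv01 ltry. Qed.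

Lemma sqint_trig1 h : trigpoly phase1 h -> L2t h.
Proof. exact: sqint_trigpoly mI mu1 (@measurable_phase1 _ _). Qed.

Lemma trig_cos1 (n : int) (beta : R) : trigpoly phase1 (fun t => cos (phase1 n t + beta)).
Proof.
by have := trigpoly_cos (@phase1 R) 1 n beta; under [in X in X -> _]eq_fun do rewrite mul1r.
Qed.

Lemma trig_bump (n : int) (beta : R) : trigpoly phase1 (bump n beta).
Proof.
apply: trigpolyD (trig_cos1 n beta) (trigpoly_cst (@phase1D R) _).
Qed.

Lemma trig_dbump (n : int) (beta : R) : trigpoly phase1 (dbump n beta).
Proof.
have := trigpoly_cos (@phase1 R) (- (2 * pi * n%:~R)) n (beta - pi / 2).
congr trigpoly; apply/funext => t.
by rewrite addrA cosBpihalf mulNr.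
Qed.

(** h minus its mean is orthogonal to all trigonometric polynomials, which are dense,
    hence to itself. *)
Lemma ae_cst_of_orthogonal h : L2t h ->
  (forall (n : int) (beta : R), n != 0 -> ip1 h (fun t => cos (phase1 n t + beta)) = 0) ->
  exists m : R, {ae leb1, forall t, I01 t -> h t = m}.
Proof.
move=> Lh hn.
have Lc (c : R) : L2t (fun=> c) by exact: sqint_cst.
pose m := ip1 h (fun=> 1); exists m.
pose h0 t := h t - m; have Lh0 : L2t h0 by exact: sqintB.
have ip11 (c : R) : ip1 (fun=> c) (fun=> 1) = c.
  rewrite /ip; under eq_Rintegral do rewrite mulr1.
  by rewrite Rintegral_cst// [X in _ * fine X]leb1_itv01 mulr1.
have h0T p : trigpoly phase1 p -> ip1 h0 p = 0.
  elim=> [a k b|p1 p2 T1 I1 T2 I2]; last first.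
    by rewrite (ipDr mI) ?I1 ?I2 ?addr0//; exact: sqint_trig1.
  have Lcos := sqint_trig1 (trig_cos1 k b).
  rewrite (ipZr mI)//; have [->|k0] := eqVneq k 0.
    rewrite (_ : (fun _ => _) = (fun t : R => cos b * 1)); last first.
      by apply/funext => t; rewrite /phase1 mulr0 mul0r add0r mulr1.
    by rewrite (ipZr mI)// (ipBl mI)// ip11 subrr !mulr0.
  rewrite (ipBl mI)// hn// sub0r.
  rewrite (_ : ip1 _ _ = 0) ?oppr0 ?mulr0//.
  rewrite (_ : (fun=> m) = (fun t : R => m * 1)); last by rewrite mulr1.
  rewrite (ipZl mI)// (_ : ip1 _ _ = 0) ?mulr0//.
  rewrite /ip; under eq_Rintegral do rewrite mul1r.
  apply: (@Rintegral_cos_period _ 1 (2 * pi * k%:~R) b k) => //.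
  by rewrite mulr1.
have h00 : ip1 h0 h0 = 0.
  apply/eqP; rewrite eq_le ip_ge0 andbT; apply/ler_addgt0Pl => e e0.
  have [_ /(_ _ e0)[p Tp hp]] := dense_trigpoly1 Lh0.
  rewrite addr0; apply: le_trans (ltW hp); have Lp := sqint_trig1 Tp.
  by rewrite [leRHS](ip_subK mI Lh0 Lp) (h0T p Tp) mulr0 subr0 lerDl ip_ge0.
apply: ae_imp (ip_eq0_ae mI Lh0 h00) => t ht It.
by apply/eqP; rewrite -subr_eq0; apply/eqP; exact: ht.
Qed.

Section Primitive.
Variable b : R -> R.
Hypothesis intb : leb1.-integrable I01 (EFin \o b).

Definition primitive (t : R) : R := \int[leb1]_(s in `[0, t]) b s.

Lemma continuous_primitive : {within `[0, 1], continuous primitive}.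
Proof. exact: parameterized_integral_continuous ler01 intb. Qed.

(** Writing the primitive over a fixed interval makes it an integral in two
    variables, to which Fubini applies. *)
Lemma primitive_itv01 t : I01 t ->
  primitive t = \int[leb1]_(s in I01) (b s * (s <= t)%R%:R).
Proof.
rewrite /= in_itv/= => /andP[t0 t1].
transitivity (\int[leb1]_(s in I01 `&` [set s | s <= t]) b s).
  congr Rintegral; apply/seteqP; split => s /=; rewrite !in_itv/=.
    by move=> /andP[s0 st]; rewrite s0 st (le_trans st).
  by move=> [/andP[-> _] ->].
rewrite Rintegral_mkcondr; apply: eq_Rintegral => s _; rewrite patchE.
case: ifPn => [/set_mem/= ->|]; first by rewrite mulr1.
by rewrite notin_setE/= => /negP/negbTE ->; rewrite mulr0.
Qed.

Let le_ind (z : R * R) : R := (z.2 <= z.1)%R%:R.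

Let measurable_le_ind D : measurable_fun D (le_ind : measurableTypeR R * measurableTypeR R -> R).
Proof.
apply: measurable_funTS.
rewrite (_ : le_ind = \1_[set z | z.2 <= z.1]).
  apply: measurable_indic.
  rewrite [X in measurable X](_ : _ = setT `&` (fun z : R * R => z.2 <= z.1) @^-1` [set true]).
    by apply: measurable_fun_ler.
  by rewrite setTI; apply/seteqP; split => z.
apply/funext => z; rewrite /le_ind indicE; congr (nat_of_bool _)%:R.
by apply/idP/idP => [h|/set_mem//]; rewrite mem_set.
Qed.

Let le_ind_le1 z : `|le_ind z| <= 1.
Proof. by rewrite /le_ind; case: (z.2 <= z.1); rewrite /= ?normr1 ?normr0. Qed.

Let measurable_le_indl t D : measurable_fun D (fun s : R => (s <= t)%R%:R : R).
Proof.
apply: measurable_funTS.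
rewrite (_ : (fun s : R => _) = \1_(`]-oo, t]%classic)).
  by apply: measurable_indic; exact: measurable_itv.
apply/funext => s; rewrite indicE; congr (nat_of_bool _)%:R.
by apply/idP/idP; rewrite inE/= in_itv.
Qed.

Lemma integrable_trunc t : leb1.-integrable I01 (fun s => (b s * (s <= t)%R%:R)%:E).
Proof.
apply: le_integrable intb => //.
  apply/measurable_EFinP/measurable_funM; last exact: measurable_le_indl.
  by apply/measurable_EFinP; exact: measurable_int intb.
move=> s _; rewrite lee_fin normrM -[leRHS]mulr1 ler_wpM2l//.
exact: (le_ind_le1 (t, s)).
Qed.

Lemma sqint_primitive : L2t primitive.
Proof.
have mB : measurable_fun (I01 : set R) primitive.
  apply: subspace_continuous_measurable_fun => //.
  exact: continuous_primitive.
apply: (@sqint_bounded _ _ _ _ _ mI primitive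
    (\int[leb1]_(s in I01) `|b s|) mu1) => // t It.
rewrite primitive_itv01//; apply: le_trans (le_normr_Rintegral mI (integrable_trunc t)) _.
apply: le_Rintegral => //.
- exact: integrable_norm (integrable_trunc t).
- exact: integrable_norm intb.
- move=> s _; rewrite normrM -[leRHS]mulr1 ler_wpM2l//.
  exact: (le_ind_le1 (t, s)).
Qed.

(** The fundamental theorem of calculus on [s,1], where bump vanishes at 1. *)
Lemma Rintegral_dbump (n : int) (beta s : R) : I01 s ->
  \int[leb1]_(t in I01) ((s <= t)%R%:R * dbump n beta t) = - bump n beta s.
Proof.
rewrite /= in_itv/= => /andP[s0 s1].
transitivity (\int[leb1]_(t in `[s, 1]) dbump n beta t).
  transitivity (\int[leb1]_(t in I01 `&` [set t | s <= t]) dbump n beta t).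
    rewrite Rintegral_mkcondr; apply: eq_Rintegral => t _; rewrite patchE.
    case: ifPn => [/set_mem/= ->|]; first by rewrite mul1r.
    by rewrite notin_setE/= => /negP/negbTE ->; rewrite mul0r.
  congr Rintegral; apply/seteqP; split => t /=; rewrite !in_itv/=.
    by move=> [/andP[_ ->] ->].
  by move=> /andP[st ->]; rewrite st (le_trans s0 st).
have [->|sn1] := eqVneq s 1.
  rewrite bump1 oppr0 /Rintegral (_ : (\int[_]_(_ in _) _)%E = 0%E)//.
  by rewrite set_itv1; exact: integral_set1.
have {}s1 : s < 1 by rewrite lt_neqAle sn1.
have db t : is_derive t (1 : R) (bump n beta) (dbump n beta t) by exact: is_derive_bump.
have cb : continuous (bump n beta).
  move=> t; apply: differentiable_continuous; apply/derivable1_diffP.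
  exact: ex_derive.
have cdb : continuous (dbump n beta).
  move=> t; apply: cvgN; apply: cvgM; first exact: cvg_cst.
  apply: continuous_comp; last exact: continuous_sin.
  by apply: cvgD; [apply: cvgM; [exact: cvg_cst|exact: cvg_id]|exact: cvg_cst].
rewrite /Rintegral (_ : (\int[_]_(_ in _) _)%E = ((bump n beta 1)%:E - (bump n beta s)%:E)%E).
  by rewrite bump1 sub0e.
apply: continuous_FTC2 => //.
- exact: continuous_subspaceT.
- split.
  + by move=> t _; exact: ex_derive.
  + exact: cvg_at_right_filter (cb s).
  + exact: cvg_at_left_filter (cb 1).
- by move=> t _; rewrite derive1E derive_val.
Qed.

(** Integration by parts for a primitive of a merely integrable function: exchange the
    two integrals, then integrate the derivative of the test function. *)
Lemma ip_primitive_dbump (n : int) (beta : R) :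
  ip1 primitive (dbump n beta) = - \int[leb1]_(t in I01) (bump n beta t * b t).
Proof.
pose J : set (measurableTypeR R) := I01.
pose F (z : R * R) : R := b z.2 * (le_ind z * dbump n beta z.1).
have Td := trig_dbump n beta; have [C hC] := trigpoly_bounded Td.
have md D : measurable_fun D (dbump n beta : R -> R).
  exact: measurable_trigpoly (@measurable_phase1 _ _) Td.
have mb : measurable_fun (I01 : set R) b.
  by apply/measurable_EFinP; exact: measurable_int intb.
have mb2 : measurable_fun (J `*` J) (fun z : R * R => b z.2).
  apply: (measurable_comp (F := (I01 : set (measurableTypeR R))) (f := b)) => //.
    by move=> _ [[t x] [/= _ Ix] <-].
  by apply: measurable_funTS; exact: measurable_snd.
have mF : measurable_fun (J `*` J) F.
  apply: measurable_funM => //; apply: measurable_funM; first exact: measurable_le_ind.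
  by apply: measurable_funTS; apply: (measurableT_comp (md setT)); exact: measurable_fst.
have intF : (leb1 \x leb1)%E.-integrable (J `*` J) (EFin \o F).
  apply/integrableP; split; first exact/measurable_EFinP.
  apply: (@le_lt_trans _ _ (\int[leb1 \x leb1]_(z in J `*` J) (C * `|b z.2|)%:E)%E).
    apply: ge0_le_integral => //.
    - exact: measurableX.
    - by apply: measurableT_comp => //; exact/measurable_EFinP.
    - apply/measurable_EFinP; apply: measurable_funM => //.
      by apply: measurableT_comp.
    - move=> z _; rewrite abse_EFin lee_fin normrM mulrC ler_wpM2r// normrM.
      rewrite -[leRHS]mul1r ler_pM//.
  rewrite tonelli_on//.
  - have intCb := integrable_lty mI (integrableZl mI C (integrable_norm intb)).
    rewrite (_ : (\int[leb1]_(x in J) _)%E = (\int[leb1]_(s in I01) (C * `|b s|)%:E * leb1 J)%E).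
      by rewrite [X in (_ * X)%E]leb1_itv01 mule1; exact: intCb.
    exact: (integral_cst leb1 mI (\int[leb1]_(s in I01) (C * `|b s|)%:E)%E).
  - apply/measurable_EFinP; apply: measurable_funM => //.
    by apply: measurableT_comp.
  - move=> z _; rewrite lee_fin mulr_ge0//; exact: le_trans (hC 0).
have h1 : ip1 primitive (dbump n beta) = \int[leb1]_(t in I01) \int[leb1]_(s in I01) F (t, s).
  apply: eq_Rintegral => t /set_mem It; rewrite primitive_itv01//.
  rewrite -(@RintegralZr _ _ _ leb1 _ (fun s => b s * (s <= t)%R%:R)
    (dbump n beta t) mI (integrable_trunc t)).
  by apply: eq_Rintegral => s _; rewrite /F /le_ind/= mulrA.
rewrite h1 -(Fubini1_on mI mI intF) (Fubini2_on mI mI intF).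
rewrite -[RHS]mulN1r -RintegralZl//; last first.
  have [C' hC'] := trigpoly_bounded (trig_bump n beta).
  apply: (integrable_bmul mI intb (C := C')) => //.
  exact: measurable_trigpoly (@measurable_phase1 _ _) (trig_bump n beta).
apply: eq_Rintegral => s /set_mem Is.
have intd : leb1.-integrable I01 (fun t => ((s <= t)%R%:R * dbump n beta t)%:E).
  have intd := sqint_mul mI (sqint_trig1 Td) (sqint_cst mI 1 mu1).
  apply: (integrable_bmul mI (C := 1)) => [||t _].
  - by apply: eq_integrable intd => // t _; rewrite /= mulr1.
  - rewrite (_ : (fun t : R => _) = \1_(`[s, +oo[%classic)).
      by apply: measurable_indic; exact: measurable_itv.
    apply/funext => t; rewrite indicE; congr (nat_of_bool _)%:R.
    by apply/idP/idP; rewrite inE/= in_itv/= andbT.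
  - exact: (le_ind_le1 (t, s)).
rewrite -[RHS]/(-1 * (bump n beta s * b s)) mulrA mulN1r -(Rintegral_dbump n beta Is).
rewrite mulrC -(@RintegralZl _ _ _ leb1 _
  (fun t => (s <= t)%R%:R * dbump n beta t) (b s) mI intd).
by apply: eq_Rintegral => t _; rewrite /F /le_ind.
Qed.

End Primitive.

(** The difference between a and the primitive of b has zero weak derivative, so it is
    orthogonal to all derivatives of test functions, that is to all nonconstant cosines, and it is
    constant. *)
Lemma ae_continuous_of_weak_derivative a b : L2t a ->
  leb1.-integrable I01 (EFin \o b) ->
  (forall (n : int) (beta : R),
    ip1 a (dbump n beta) + \int[leb1]_(t in I01) (bump n beta t * b t) = 0) ->
  exists2 c : R -> R, {within `[0, 1], continuous c} &
    {ae leb1, forall t, I01 t -> a t = c t}.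
Proof.
move=> La intb ab.
have LB := sqint_primitive intb.
have [m hm] : exists m : R, {ae leb1, forall t, I01 t -> a t - primitive b t = m}.
  apply: (@ae_cst_of_orthogonal (fun t => a t - primitive b t)).
    exact: sqintB.
  move=> n beta n0.
  have Ld := sqint_trig1 (trig_dbump n (beta + pi / 2)).
  have h0 : ip1 (fun t => a t - primitive b t) (dbump n (beta + pi / 2)) = 0.
    by rewrite (ipBl mI)// ip_primitive_dbump// opprK ab.
  have n0' : - (2 * pi * n%:~R) != 0 :> R.
    by rewrite oppr_eq0 !mulf_eq0 intr_eq0 (negbTE n0) pnatr_eq0 orbF/= gt_eqF ?pi_gt0.
  apply: (mulfI n0'); rewrite mulr0; apply: etrans h0.
  rewrite -(ipZr mI) //; last exact: sqintB.
    by apply: eq_ip => // t _; rewrite /dbump addrA sinDpihalf mulNr.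
  exact: sqint_trig1 (trig_cos1 _ _).
exists (fun t => primitive b t + m).
  move=> t; apply: cvgD; last exact: cvg_cst.
  exact: (continuous_primitive intb).
by apply: ae_imp hm => t h It; rewrite -(h It) addrC subrK.
Qed.

End DuBoisReymond.

(** * Uniform limits of continuous functions, almost everywhere *)

Section UniformLimits.
Context {R : realType}.
Local Notation leb1 := (@leb1 R).
Implicit Types (g c : R -> R).

(** Continuity on [0,1] in terms of distances, which avoids neighbourhoods in a
    subspace topology. *)
Lemma within_continuousP g : {within `[0, 1], continuous g} <->
  forall t, I01 t -> forall e : R, 0 < e ->
    exists2 d, 0 < d & forall s, I01 s -> `|t - s| < d -> `|g t - g s| < e.
Proof.
split=> [/subspace_continuousP cg t It e e0|gP].
  have /cvgrPdist_lt/(_ e e0) := cg t It.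
  rewrite /within/= => -[d/= d0 dP]; exists d => // s Is ts.
  by apply: (dP s).
apply/subspace_continuousP => t It; apply/cvgrPdist_lt => e e0.
have [d d0 dP] := gP t It e e0.
by rewrite /within/=; exists d => //= s ts Is; exact: dP.
Qed.

(** If g t > K then g > K on a nondegenerate interval of [0,1] around t, which is not
    negligible. *)
Lemma within_continuous_ae_le g (K : R) : {within `[0, 1], continuous g} ->
  {ae leb1, forall t, I01 t -> g t <= K} -> forall t, I01 t -> g t <= K.
Proof.
move=> /within_continuousP cg [N [mN N0 gN]] t It; rewrite leNgt; apply/negP => Kg.
have [d d0 dP] := cg t It (g t - K) ltac:(rewrite subr_gt0//).
move: (It); rewrite /= in_itv/= => /andP[t0 t1].
pose a := Num.max 0 (t - d / 2); pose b := Num.min 1 (t + d / 2).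
have ab : a < b.
  by rewrite /a /b lt_min !gt_max !ltr01/=; apply/andP; split; [|apply/andP; split]; lra.
have abN : `[a, b]%classic `<=` N.
  move=> s /=; rewrite in_itv/= => /andP[]; rewrite /a /b ge_max le_min.
  move=> /andP[s0 ts] /andP[s1 st]; apply: gN => /= sI.
  have Is : I01 s by rewrite /= in_itv/= s0.
  have := dP s Is; rewrite !ltr_norml => /(_ _)/andP[|_].
    by apply/andP; split; lra.
  by have := sI Is; lra.
have : (leb1 `[a, b]%classic <= leb1 N)%E.
  by apply: le_measure => //; rewrite inE; [exact: measurable_itv|].
rewrite N0 [leb1 _]lebesgue_measure_itv/= lte_fin ab -EFinD lee_fin subr_le0.
by rewrite leNgt ab.
Qed.

(** Approximations c_n within 1 / (n + 1) of F almost everywhere satisfy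
    |c_n - c_m| <= 1 / (n + 1) + 1 / (m + 1) everywhere, by continuity.  They converge uniformly
    on [0,1], and their limit is continuous. *)
Lemma ae_continuous_uniform (F : R -> R) :
  (forall e : R, 0 < e -> exists2 c : R -> R, {within `[0, 1], continuous c} &
     {ae leb1, forall t, I01 t -> `|F t - c t| <= e}) ->
  exists2 c : R -> R, {within `[0, 1], continuous c} &
    {ae leb1, forall t, I01 t -> F t = c t}.
Proof.
move=> Fc.
have /choice[c_ hc] : forall n, exists c : R -> R, {within `[0, 1], continuous c} /\
    {ae leb1, forall t, I01 t -> `|F t - c t| <= n.+1%:R^-1}.
  by move=> n; have [|c c1 c2] := Fc n.+1%:R^-1; [|exists c].
have cc n : {within `[0, 1], continuous (c_ n)} by case: (hc n).
have Fcn := ae_foralln (fun n => (hc n).2).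
have cnm n m t : I01 t -> `|c_ n t - c_ m t| <= n.+1%:R^-1 + m.+1%:R^-1.
  move: t; apply: within_continuous_ae_le.
    by move=> t; apply: cvg_norm; apply: cvgB; exact: cc.
  apply: ae_imp Fcn => t h It.
  by rewrite -(subrKA (F t)) (le_trans (ler_normD _ _))// lerD ?h// distrC h.
have h0 : n.+1%:R^-1 @[n --> \oo] --> (0 : R) by exact: cvg_harmonic.
have lim_le t n : I01 t -> `|c_ n t - limn (c_ ^~ t)| <= n.+1%:R^-1.
  move=> It; have cvgt : cvgn (c_ ^~ t).
    apply/cauchy_cvgP/cauchy_exP => e e0.
    have [N _ hN] := cvgr_lt _ h0 (e / 2) ltac:(by rewrite divr_gt0).
    exists (c_ N t), N => //= m Nm; rewrite /ball/=.
    apply: le_lt_trans (cnm N m t It) _.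
    by rewrite [e]splitr ltrD//; [exact: (hN _ (leqnn N))|exact: hN].
  apply/ler_addgt0Pr => e e0; near \oo => m.
  rewrite -(subrKA (c_ m t)) (le_trans (ler_normD _ _))//.
  have h1 : `|limn (c_ ^~ t) - c_ m t| < e / 2.
    by near: m; move/cvgrPdist_lt : cvgt; apply; rewrite divr_gt0.
  have h2 : m.+1%:R^-1 < e / 2 by near: m; apply: (cvgr_lt _ h0); rewrite divr_gt0.
  rewrite distrC in h1; rewrite [e]splitr addrA lerD ?(ltW h1)//.
  by rewrite (le_trans (cnm n m t It))// lerD2l ltW.
exists (fun t => limn (c_ ^~ t)).
  apply/within_continuousP => t It e e0.
  have [N _ /(_ N (leqnn N))/= hN] := cvgr_lt _ h0 (e / 3) ltac:(by rewrite divr_gt0).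
  have /within_continuousP/(_ t It (e / 3))[|d d0 dP] := cc N; first by rewrite divr_gt0.
  exists d => // s Is /(dP s Is); have := lim_le s N Is; have := lim_le t N It.
  move: hN; set q : R := N.+1%:R^-1; clearbody q => hN.
  by rewrite !ler_norml !ltr_norml => /andP[? ?] /andP[? ?] /andP[? ?]; apply/andP; split; lra.
apply: ae_imp Fcn => t h It.
apply/esym/cvg_lim => //; apply: (@cvg_le_harmonic _ _ _ 1) => n.
by rewrite mul1r distrC h.
Unshelve. all: by end_near. Qed.

End UniformLimits.

(** * Energy of a weak limit in finitely many modes *)

Section WeakLimits.
Context {R : realType}.
Local Notation leb1 := (@leb1 R).
Local Notation leb2 := (@leb2 R).
Local Notation leb3 := (@leb3 R).
Local Notation torus := (@torus R).
Local Notation spacetime := (@spacetime R).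
Local Notation ip1 := (ip leb1 I01).
Local Notation ip2 := (ip leb2 torus).
Local Notation ip3 := (ip leb3 spacetime).
Local Notation L2t := (sqint leb1 I01).
Local Notation L2tx := (sqint leb3 spacetime).
Implicit Types (f g : R * (R * R) -> R).

Let mI : measurable (I01 : set (measurableTypeR R)).
Proof. exact: measurable_itv. Qed.

Let mST := @measurable_spacetime R.
Let muST := @leb3_spacetime_lty R.

Lemma cvg_le_frequently (x : nat -> R) (l y : R) : x n @[n --> \oo] --> l ->
  (forall N, exists2 j, (N <= j)%N & x j <= y) -> l <= y.
Proof.
move=> xl fr; rewrite leNgt; apply/negP => yl.
have [N _ hN] := cvgr_gt _ xl _ yl; have [j Nj] := fr N.
by rewrite leNgt hN.
Qed.

(** Let Q(f)(t) be the sum of the squares of the coefficients of f(t) on the functions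
    e i.  Although its integral over a set of times
    is not weakly continuous, it is weakly lower semicontinuous.
    Take for S the set where Q(theta) > delta, and let psi(t) be the combination of the e i with
    the coefficients of theta(t) if t lies in S, and 0 otherwise.  By Young's inequality
    2 <thetaj, psi> <= \int_S Q(thetaj) + \int_S Q(theta) <= delta |S| + \int_S Q(theta)
    for infinitely many j.  In the limit the left-hand side is 2 \int_S Q(theta), so that
    \int_S (Q(theta) - delta) <= 0 and S is negligible. *)
Lemma weak_limit_energy_le (I : Type) (G : seq I) (e : I -> R * R -> R)
    (thetaj : nat -> R * (R * R) -> R) (theta : R * (R * R) -> R) (delta : R) :
  (forall i, measurable_fun torus (e i)) -> (forall i x, `|e i x| <= 1) ->
  (forall j, L2tx (thetaj j)) -> L2tx theta ->
  (forall psi, L2tx psi -> ip3 (thetaj j) psi @[j --> \oo] --> ip3 theta psi) ->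
  (forall N, exists2 j, (N <= j)%N & {ae leb1, forall t, I01 t ->
     \sum_(i <- G) ip2 (slice (thetaj j) t) (e i) ^+ 2 <= delta}) ->
  {ae leb1, forall t, I01 t ->
     \sum_(i <- G) ip2 (slice theta t) (e i) ^+ 2 <= delta}.
Proof.
move=> me e1 Lj Lth wcv fr.
have La f i : L2tx f -> L2t (fun t => ip2 (slice f t) (e i)).
  by move=> Lf; apply: (sqint_coefficient Lf (me i) (C := 1)) => x _.
pose a f i t := ip2 (slice f t) (e i).
pose Q f t := \sum_(i <- G) a f i t ^+ 2.
have mQ f : L2tx f -> measurable_fun (I01 : set R) (Q f).
  by move=> Lf; apply: measurable_sum => i; apply: measurable_funX; exact: (La f i Lf).1.
pose S := I01 `&` [set t | delta < Q theta t].
have mS : measurable (S : set (measurableTypeR R)).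
  have := mQ _ Lth mI `]delta, +oo[%classic; rewrite (_ : _ @^-1` _ = [set t | delta < Q theta t]).
    by apply; exact: measurable_itv.
  by apply/seteqP; split => t /=; rewrite in_itv/= andbT.
pose chi : R -> R := \1_S.
have mchi D : measurable_fun D (chi : measurableTypeR R -> R) by exact: measurable_indic.
have chi1 t : `|chi t| <= 1.
  by rewrite /chi indicE; case: (_ \in _); rewrite /= ?normr1 ?normr0.
have chi0 t : 0 <= chi t by rewrite /chi indicE.
have Lachi f i : L2tx f -> L2t (fun t => a f i t * chi t).
  by move=> Lf; apply: (sqint_bmul mI (La f i Lf) (mchi _) (C := 1)) => t _.
pose psi z := \sum_(i <- G) (a theta i z.1 * chi z.1) * e i z.2.
have Lpsii i : L2tx (fun z => (a theta i z.1 * chi z.1) * e i z.2).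
  by apply: (sqint_tensor (Lachi theta i Lth) (me i) (C := 1)) => x _.
have Lpsi : L2tx psi by exact: sqint_sum.
have ipsi f : L2tx f ->
    ip3 f psi = \sum_(i <- G) ip1 (a f i) (fun t => a theta i t * chi t).
  move=> Lf; rewrite ipC (ip_suml mST)//; apply: eq_bigr => i _; rewrite ipC.
  exact: (ip3_tensor Lf (me i) (fun x _ => e1 i x) (Lachi theta i Lth)).
pose E f := \sum_(i <- G) ip1 (a f i) (fun t => a f i t * chi t).
have young f : L2tx f -> 2 * ip3 f psi <= E f + E theta.
  move=> Lf; rewrite ipsi// mulr_sumr -big_split; apply: ler_sum => i _.
  exact: (ip_young mI (La f i Lf) (La theta i Lth) (mchi _) chi0 chi1).
have intE f : L2tx f ->
    leb1.-integrable I01 (fun t => (\sum_(i <- G) a f i t * (a f i t * chi t))%:E) /\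
    \int[leb1]_(t in I01) (\sum_(i <- G) a f i t * (a f i t * chi t)) = E f.
  move=> Lf; apply: Rintegral_sum => // i.
  by apply: sqint_mul => //; [exact: La|exact: Lachi].
have sumE f t : \sum_(i <- G) a f i t * (a f i t * chi t) = chi t * Q f t.
  by rewrite /Q mulr_sumr; apply: eq_bigr => i _; ring.
have intchi : leb1.-integrable I01 (fun t => (delta * chi t)%:E).
  have mu1 : (leb1 I01 < +oo)%E by rewrite leb1_itv01 ltry.
  have Ld : L2t (cst delta).
    exact: (sqint_cst mI delta mu1).
  have L1 : L2t chi.
    by apply: (@sqint_bounded _ _ _ _ _ mI chi 1) => //; exact: mchi.
  exact: (sqint_mul mI Ld L1).
pose m := \int[leb1]_(t in I01) (delta * chi t).
have Ej j : {ae leb1, forall t, I01 t -> Q (thetaj j) t <= delta} -> E (thetaj j) <= m.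
  move=> h; have [i1 i2] := intE _ (Lj j).
  rewrite -i2; apply: ae_le_Rintegral => //; apply: ae_imp h => t h It.
  by rewrite sumE mulrC ler_wpM2r// h.
have Eth : E theta <= m.
  have h : 2 * ip3 (thetaj j) psi @[j --> \oo] --> 2 * ip3 theta psi.
    exact: cvgM (cvg_cst _) (wcv _ Lpsi).
  have : 2 * ip3 theta psi <= m + E theta.
    apply: (cvg_le_frequently h) => N; have [j Nj hj] := fr N; exists j => //.
    by apply: le_trans (young _ (Lj j)) _; rewrite lerD2r; exact: Ej.
  rewrite ipsi// -/(E theta); lra.
have [i1 i2] := intE _ Lth.
have : {ae leb1, forall t, I01 t -> chi t * Q theta t - delta * chi t = 0}.
  apply: ae_eq0_of_Rintegral_le0 => //.
  - by apply: eq_integrable (integrableB mI i1 intchi) => // t _; rewrite /= sumE.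
  - move=> t It; rewrite [delta * _]mulrC -mulrBr /chi indicE.
    have [/set_mem[_ /= h]|_] := boolP (t \in S); last by rewrite mul0r.
    by rewrite mul1r subr_ge0 ltW.
  - rewrite RintegralB//; last first.
      by apply: eq_integrable i1 => // t _; rewrite sumE.
    rewrite -/m subr_le0; apply: le_trans Eth; rewrite -i2.
    by under [leRHS]eq_Rintegral do rewrite sumE.
apply: ae_imp => t h It; rewrite leNgt; apply/negP => dQ.
have := h It; rewrite /chi indicE mem_set; last by split.
by rewrite mul1r mulr1 => /eqP; rewrite subr_eq0 => /eqP QE; move: dQ; rewrite -QE ltxx.
Qed.

End WeakLimits.

(** * Continuity of the energy of the limit *)

Lemma exists_powR_tail_le (R : realType) (s A e : R) : 0 < s -> 0 < e ->
  exists2 N : nat, (0 < N)%N & A ^+ 2 / (N%:R `^ s) ^+ 2 <= e.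
Proof.
move=> s0 e0; pose K := 1 + A ^+ 2 / e.
have K1 : 1 <= K by rewrite lerDl divr_ge0 ?sqr_ge0 ?ltW.
have K0 : 0 < K by exact: lt_le_trans K1.
have N0 : 0 <= K `^ s^-1 by exact: powR_ge0.
pose N := (Num.bound (K `^ s^-1)).+1.
have KN : K <= N%:R `^ s.
  have -> : K = (K `^ s^-1) `^ s by rewrite -powRrM mulVf ?gt_eqF// powRr1// ltW.
  have KN : K `^ s^-1 <= N%:R.
    by apply: le_trans (ltW (archi_boundP N0)) _; rewrite ler_nat.
  by apply: ge0_ler_powR => //; rewrite ?nnegrE ?ltW.
exists N => //.
have hN : A ^+ 2 / e <= (N%:R `^ s) ^+ 2.
  have : A ^+ 2 / e <= K by rewrite lerDr ler01.
  move=> /le_trans; apply; apply: (le_trans KN).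
  by rewrite expr2 ler_peMl ?powR_ge0// (le_trans K1).
have P0 : 0 < (N%:R `^ s) ^+ 2 by rewrite exprn_gt0// (lt_le_trans K0).
by rewrite ler_pdivrMr// -ler_pdivrMl// mulrC.
Qed.

Section FourierCoefficients.
Context {R : realType}.
Local Notation phase := (@phase R).
Local Notation freq := (@freq R).
Local Notation leb1 := (@leb1 R).
Local Notation leb2 := (@leb2 R).
Local Notation leb3 := (@leb3 R).
Local Notation torus := (@torus R).
Local Notation spacetime := (@spacetime R).
Local Notation ip2 := (ip leb2 torus).
Local Notation ip3 := (ip leb3 spacetime).
Local Notation L2tx := (sqint leb3 spacetime).
Implicit Types (theta : R * (R * R) -> R).

Let mST := @measurable_spacetime R.

(** The limit equation tested on [test] says that the coefficient has the weak derivative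
    <theta(t), w(t)>, where w = u . grad cos (k.x + c). *)
Lemma coefficient_ae_continuous u (theta0 : R * R -> R) (thetak : nat -> R * (R * R) -> R)
    theta (kappa : nat -> R) (k : int * int) (c : R) :
  in_Linf u -> (forall j, weak_solution (kappa j) u theta0 (thetak j)) ->
  kappa j @[j --> \oo] --> 0 -> weakstar_cvg thetak theta ->
  in_Linf_L2 theta ->
  exists2 a : R -> R, {within `[0, 1], continuous a} &
    {ae leb1, forall t, I01 t ->
      ip2 (slice theta t) (fun x => cos (phase k x + c)) = a t}.
Proof.
move=> Lu sol k0 wcv Linf; have Lth := Linf_L2_sqint Linf.
(* - sin is written as a shifted cosine, so that w is a combination of
   trigonometric polynomials with the components of u as coefficients. *)
pose dcos (a : R) (z : R * (R * R)) : R := a * cos (phase k z.2 + (c + pi / 2)).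
have Tdcos a : trigpoly lin3 (dcos a).
  have := trigpoly_cos lin3 a (0, ((freq k).1, (freq k).2)) (c + pi / 2).
  congr trigpoly; apply/funext => z; rewrite /dcos /lin3 /phase/=.
  by congr (_ * cos (_ + _)); ring.
pose w z := (u z).1 * dcos (freq k).1 z + (u z).2 * dcos (freq k).2 z.
have Lw : L2tx w.
  have [L1 L2] := sqint_velocity Lu.
  by apply: sqintD => //; [have [C hC] := trigpoly_bounded (Tdcos (freq k).1)
    |have [C hC] := trigpoly_bounded (Tdcos (freq k).2)];
    [apply: (sqint_bmul mST L1 _ (fun z _ => hC z))
    |apply: (sqint_bmul mST L2 _ (fun z _ => hC z))]; exact: (sqint_trig3 (Tdcos _)).1.
have me : measurable_fun torus (fun x => cos (phase k x + c)) by exact: measurable_cos_phase.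
have e1 x : torus x -> `|cos (phase k x + c)| <= 1 by move=> _; exact: cos_norm_le1.
apply: (@ae_continuous_of_weak_derivative _ _ (fun t => ip2 (slice theta t) (slice w t))).
- exact: (sqint_coefficient Lth me e1).
- exact: integrable_ip_slices.
move=> n beta.
have t0 x : test n beta k c (0, x) = 0 by rewrite /test bump0 mul0r.
have t1 x : test n beta k c (1, x) = 0 by rewrite /test bump1 mul0r.
have := limit_equation Lu sol k0 wcv Linf (trig3_test n beta k c)
  (periodic_test n beta k c) t0 t1.
have -> : dt (test n beta k c) = fun z => dbump n beta z.1 * cos (phase k z.2 + c).
  by apply/funext => z; rewrite dt_test.
have -> : advect u (test n beta k c) = fun z => bump n beta z.1 * w z.
  apply/funext => z; rewrite /advect dx_test dy_test /w /dcos addrA cosDpihalf; ring.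
rewrite (ip3_tensor Lth me e1 (sqint_trig1 (trig_dbump n beta))).
have [C hC] := trigpoly_bounded (trig_bump n beta).
have mb : measurable_fun (setT : set R) (bump n beta).
  exact: measurable_trigpoly (@measurable_phase1 _ _) (trig_bump n beta).
by rewrite (ip3_time_factor Lth Lw mb hC).
Qed.

(** A single family for cosines and sines, to which the results on the coefficients with
    respect to an arbitrary family of functions apply. *)
Definition mode (i : (int * int) * bool) (x : R * R) : R :=
  cos (phase i.1 x + (if i.2 then 0 else - (pi / 2))).

Lemma fourier_energy_modes F f : fourier_energy F f =
  \sum_(i <- [seq (k, b) | k <- F, b <- [:: true; false]]) ip2 f (mode i) ^+ 2.
Proof.
rewrite big_allpairs; apply: eq_bigr => k _.
rewrite !big_cons big_nil /= addr0 /cos_coef /sin_coef cos_phaseE sin_phaseE.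
by [].
Qed.

Lemma fourier_energy_ae_continuous u (theta0 : R * R -> R) (thetak : nat -> R * (R * R) -> R)
    theta (kappa : nat -> R) (F : seq (int * int)) :
  in_Linf u -> (forall j, weak_solution (kappa j) u theta0 (thetak j)) ->
  kappa j @[j --> \oo] --> 0 -> weakstar_cvg thetak theta ->
  in_Linf_L2 theta ->
  exists2 a : R -> R, {within `[0, 1], continuous a} &
    {ae leb1, forall t, I01 t -> fourier_energy F (slice theta t) = a t}.
Proof.
move=> Lu sol k0 wcv Linf.
have co k c := coefficient_ae_continuous k c Lu sol k0 wcv Linf.
rewrite /fourier_energy; elim: F => [|k F [a ca ha]].
  exists (cst 0); first by move=> t; exact: cvg_cst.
  by apply: aeW => t _; rewrite big_nil.
have [b cb hb] := co k 0; have [b' cb' hb'] := co k (- (pi / 2)).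
exists (fun t => b t * b t + b' t * b' t + a t).
  move=> t; apply: cvgD; last exact: ca.
  by apply: cvgD; apply: cvgM; do ?[exact: cb|exact: cb'].
have hbb := ae_imp2 (fun t p q => conj p q) hb hb'.
apply: ae_imp2 hbb ha => t /= [h1 h2] h3 It.
by rewrite big_cons (h3 It) /cos_coef /sin_coef cos_phaseE sin_phaseE (h1 It) (h2 It) !expr2.
Qed.

Lemma fourier_energy_tail (N M : nat) (f : R * R -> R) : (N <= M)%N ->
  fourier_energy (box M) f = fourier_energy (box N) f +
    fourier_energy [seq k <- box M | k \notin box N] f.
Proof.
move=> NM; rewrite /fourier_energy big_filter (bigID (mem (box N))).
congr (_ + _); rewrite -big_filter; apply: perm_big; apply: uniq_perm.
- by rewrite filter_uniq//; have [] := sym_box M.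
- by have [] := sym_box N.
move=> k; rewrite mem_filter; change ((k \in box N) && (k \in box M) = (k \in box N)).
rewrite !mem_box.
by apply: andb_idr => /andP[/leq_trans -> // /leq_trans ->].
Qed.

(** Needed to apply Bessel's inequality to the modes between two boxes. *)
Lemma sym_tail N M : sym_freqs [seq k <- box M | k \notin box N].
Proof.
have [uM sM] := sym_box M; have [_ sN] := sym_box N.
split=> [|k]; first exact: filter_uniq.
rewrite !mem_filter => /andP[kN /sM ->]; rewrite andbT.
by apply: contra kN => /sN; rewrite opprK.
Qed.

(** For every M >= N the energy in the modes between the boxes N and M is bounded, at almost
    every time, by the Sobolev bound; by Parseval's identity these energies exhaust the tail as M
    tends to infinity. *)
Lemma weak_limit_tail_le (s A : R) (N : nat)
    (thetaj : nat -> R * (R * R) -> R) theta : 0 < s -> (0 < N)%N ->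
  (forall j, L2tx (thetaj j)) -> L2tx theta ->
  (forall psi, L2tx psi -> ip3 (thetaj j) psi @[j --> \oo] --> ip3 theta psi) ->
  (forall n, exists2 j, (n <= j)%N & {ae leb1, forall t, I01 t ->
     (Hsnorm s (slice (thetaj j) t) < A%:E)%E}) ->
  {ae leb1, forall t, I01 t ->
     `|ip2 (slice theta t) (slice theta t) -
       (Num.sqrt 2)^-1 * fourier_energy (box N) (slice theta t)| <=
     A ^+ 2 / (N%:R `^ s) ^+ 2}.
Proof.
move=> s0 N0 Lj Lth wcv fr; have s2 := @sqrt2_gt0 R.
have tail M : {ae leb1, forall t, I01 t ->
    fourier_energy [seq k <- box M | k \notin box N] (slice theta t) <=
    Num.sqrt 2 * A ^+ 2 / (N%:R `^ s) ^+ 2}.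
  pose G := [seq (k, b) | k <- [seq k <- box M | k \notin box N],
                           b <- [:: true; false]].
  suff : {ae leb1, forall t, I01 t -> \sum_(i <- G) ip2 (slice theta t) (mode i) ^+ 2 <=
      Num.sqrt 2 * A ^+ 2 / (N%:R `^ s) ^+ 2}.
    by apply: ae_imp => t h It; rewrite fourier_energy_modes h.
  apply: (weak_limit_energy_le (thetaj := thetaj)) => //.
  - by move=> i; exact: measurable_cos_phase.
  - by move=> i x; exact: cos_norm_le1.
  - move=> n; have [j nj hj] := fr n; exists j => //.
    apply: ae_imp2 (ae_sqint_slice (Lj j)) hj => t /= Ljt hjt It.
    rewrite -fourier_energy_modes; apply: (sobolev_tail s0 (Ljt It) (hjt It)).
    + exact: sym_tail.
    + by rewrite ltr0n.
    + by move=> k; rewrite mem_filter => /andP[kN _]; exact: freq_norm_box.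
apply: ae_imp2 (ae_sqint_slice Lth) (ae_foralln tail) => t Lt h It.
have {}Lt := Lt It; rewrite ger0_norm ?subr_ge0; last exact: bessel (sym_box N).
apply/ler_addgt0Pr => e e0; have [N1 hN1] := parseval Lt e0.
have := hN1 (maxn N N1) (leq_maxr _ _).
rewrite (fourier_energy_tail _ (leq_maxl N N1)).
have := h (maxn N N1) It; set E1 := fourier_energy (box N) _.
set E2 := fourier_energy _ _; rewrite -mulrA mulrC -ler_pdivrMr// [_ / _]mulrC => hE.
by rewrite mulrDr opprD addrA ltrBlDr => /ltW/le_trans; apply; rewrite addrC lerD2r.
Qed.

End FourierCoefficients.

Theorem proposition1p10 (R : realType)
    (u : R * (R * R) -> R * R) (theta0 : R * R -> R)
    (thetak : R -> R * (R * R) -> R)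
    (theta : R * (R * R) -> R) (kappa : nat -> R) :
  in_Linf u -> div_free u ->
  in_L2 theta0 ->
  (forall k : R, 0 < k -> weak_solution k u theta0 (thetak k)) ->
  in_Linf_L2 theta ->
  (forall j, 0 < kappa j) ->
  kappa j @[j --> \oo] --> 0 ->
  weakstar_cvg (fun j => thetak (kappa j)) theta ->
  ~ ae_eq_continuous (energy theta) ->
  forall s : R, 0 < s ->
    Linf_time (fun t => Hsnorm s (slice (thetak (kappa j)) t))
      @[j --> \oo] --> +oo%E.
Proof.
move=> Lu _ _ sol Linf kappa0 k0 wcv disc s s0.
have {}sol j : weak_solution (kappa j) u theta0 (thetak (kappa j)) by exact: sol.
have Lj j : sqint (@leb3 R) (@spacetime R) (thetak (kappa j)).
  by apply: Linf_L2_sqint; case: (sol j).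
have Lth := Linf_L2_sqint Linf.
apply: contrapT => ninfty; apply: disc.
have [A fr] : exists A : R, forall n, exists2 j, (n <= j)%N &
    {ae (@leb1 R), forall t, I01 t -> (Hsnorm s (slice (thetak (kappa j)) t) < A%:E)%E}.
  apply: contrapT => /forallNP h; apply: ninfty; apply/cvgeyPge => A.
  have /existsNP[n hn] := h A; exists n => // j /= nj.
  rewrite leNgt; apply/negP => jA; apply: hn; exists j => //.
  have := @ess_sup_ge _ _ _ (@leb1 R)
    ((fun t => Hsnorm s (slice (thetak (kappa j)) t)) \_ `[0, 1]).
  apply: ae_imp => t /= ht It; apply: le_lt_trans jA.
  by move: ht; rewrite patchE mem_set.
have [c cc hc] : exists2 c : R -> R, {within `[0, 1], continuous c} &
    {ae (@leb1 R), forall t, I01 t ->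
      ip (@leb2 R) (@torus R) (slice theta t) (slice theta t) = c t}.
  apply: ae_continuous_uniform => e e0.
  (* N is chosen so large that the frequencies outside the box N carry energy
     at most e. *)
  have [N N0 hN] := exists_powR_tail_le A s0 e0.
  have [a ca ha] := fourier_energy_ae_continuous (box N) Lu sol k0 wcv Linf.
  exists (fun t => (Num.sqrt 2)^-1 * a t).
    by move=> t; apply: cvgM; [exact: cvg_cst|exact: ca].
  have wk psi : sqint (@leb3 R) (@spacetime R) psi ->
      ip (@leb3 R) (@spacetime R) (thetak (kappa j)) psi @[j --> \oo] -->
      ip (@leb3 R) (@spacetime R) theta psi.
    by move=> /sqint_in_L1_L2 Lpsi; exact: wcv.
  apply: ae_imp2 (weak_limit_tail_le s0 N0 Lj Lth wk fr) ha => t ht at_ It.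
  by rewrite -(at_ It); exact: le_trans (ht It) hN.
exists c => //; apply: ae_imp2 (ae_sqint_slice Lth) hc => t Lt ct It.
by rewrite /energy (ip_L2norm (Lt It)) ct.
Qed.
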